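(* Let $M=(M_t)_{t\in\mathbb{R}_+}$ be a continuous local martingale and let $\langle M\rangle$ be its quadratic variation. Then, almost surely, for all $t\in\mathbb{R}_+$, the pseudo 2-microlocal frontier of $M$ at $t$ satisfies $$\forall s'\ge -\underline{\alpha}_{M,t};\qquad \Sigma_{M,t}(s')=\tfrac12\,\Sigma_{\langle M\rangle,t}(2s').$$ Consequently (almost surely, for all $t\in\mathbb{R}_+$), the pseudo pointwise and pseudo local Hölder exponents satisfy $$\underline{\alpha}_{M,t}=\frac{\underline{\alpha}_{\langle M\rangle,t}}{2}\qquad\text{and}\qquad \widetilde{\underline{\alpha}}_{M,t}=\frac{\widetilde{\underline{\alpha}}_{\langle M\rangle,t}}{2}.$$
   Context: Pseudo 2-microlocal spaces: let $f$ be a continuous function, $t_0$ a point, $s'\in\mathbb{R}$, and let $B(t_0,\rho)$ be the open ball of center $t_0$ and radius $\rho$. For $\sigma\ge 0$, $f\in\underline{C}^{\sigma,s'}_{t_0}$ if there exist $C>0$, $\rho>0$ such that $|f(u)-f(v)|\le C|u-v|^{\sigma}(|u-t_0|+|v-t_0|)^{-s'}$ for all $u,v\in B(t_0,\rho)$ (with $u\ne v$). For $\sigma<0$, with $m=-\lfloor\sigma\rfloor$, $f\in\underline{C}^{\sigma,s'}_{t_0}$ if there exist $C,\rho>0$ such that $|I^m_{t_0+}(f-f(t_0))(u)-I^m_{t_0+}(f-f(t_0))(v)|\le C|u-v|^{\sigma+m}(|u-t_0|+|v-t_0|)^{-s'}$ for all $u,v\in B(t_0,\rho)$, where $I^m_{t_0+}g(u)=\frac{1}{\Gamma(m)}\int_{t_0}^u(u-r)^{m-1}g(r)\,dr$.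 Pseudo 2-microlocal frontier: $\Sigma_{f,t_0}(s')=\sup\{\sigma\in\mathbb{R}: f\in\underline{C}^{\sigma,s'}_{t_0}\}$ for $s'\in\mathbb{R}$. Pseudo pointwise and local Hölder exponents: $\underline{\alpha}_{f,t_0}=\sup\{\alpha:\limsup_{\rho\to0}\sup_{u,v\in B(t_0,\rho)}|f(u)-f(v)|/\rho^{\alpha}<\infty\}=-\inf\{s':\Sigma_{f,t_0}(s')\ge0\}$ and $\widetilde{\underline{\alpha}}_{f,t_0}=\sup\{\alpha:\limsup_{\rho\to0}\sup_{u,v\in B(t_0,\rho)}|f(u)-f(v)|/|u-v|^{\alpha}<\infty\}=\Sigma_{f,t_0}(0)$. For a stochastic process these quantities are those of its sample paths, hence random. For functions defined on $\mathbb{R}_+$ only, $u,v$ range over $B(t_0,\rho)\cap\mathbb{R}_+$. *)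

(* Defs.v *)
From HB Require Import structures.
From mathcomp Require Import all_boot all_order all_algebra.
From mathcomp Require Import all_classical all_reals all_analysis.

Set Implicit Arguments.
Unset Strict Implicit.
Unset Printing Implicit Defensive.

Import Order.TTheory GRing.Theory Num.Theory.
Import numFieldNormedType.Exports.

Local Open Scope classical_set_scope.
Local Open Scope ring_scope.

Section Regularity.
Context {R : realType}.

Definition half_line : set R := [set t | 0 <= t].

(* A function is given on a domain D (R or R_+) by any function on R; only its
   values on D matter. *)
Implicit Types (D : set R) (f g : R -> R).

Definition oriented_int g (a b : R) : R :=
  if a <= b then \int[lebesgue_measure]_(r in `[a, b]) g r
  else - \int[lebesgue_measure]_(r in `[b, a]) g r.

(* Gamma(m) is written (m - 1)!; only m >= 1 is meaningful. *)
Definition riemann_liouville (m : nat) (t0 : R) g : R -> R := fun u =>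
  (m.-1`!)%:R^-1 * oriented_int (fun r => (u - r) ^+ m.-1 * g r) t0 u.

(* u != v keeps the bases of both powers positive. *)
Definition increment_bound D g (t0 sigma s' : R) : Prop :=
  exists C rho : R, [/\ 0 < C, 0 < rho &
    forall u v, D u -> D v -> ball t0 rho u -> ball t0 rho v -> u != v ->
      `|g u - g v| <=
        C * (`|u - v| `^ sigma) * ((`|u - t0| + `|v - t0|) `^ (- s'))].

Definition pseudo_2ml_space D (t0 sigma s' : R) f : Prop :=
  if 0 <= sigma then increment_bound D f t0 sigma s'
  else let m := `|- Num.floor sigma|%N in
    increment_bound D (riemann_liouville m t0 (fun r => f r - f t0)) t0
      (sigma + m%:R) s'.

Definition pseudo_frontier D f (t0 s' : R) : \bar R :=
  ereal_sup [set sigma%:E | sigma in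
    [set sigma : R | pseudo_2ml_space D t0 sigma s' f]].

Definition pseudo_pointwise_exponent D f (t0 : R) : \bar R :=
  ereal_sup [set alpha%:E | alpha in [set alpha : R |
    (limf_esup (fun rho : R => ereal_sup
       [set x | exists u v, [/\ D u, D v, ball t0 rho u, ball t0 rho v &
                  x = (`|f u - f v| / rho `^ alpha)%:E]])
     0^'+ < +oo)%E]].

Definition pseudo_local_exponent D f (t0 : R) : \bar R :=
  ereal_sup [set alpha%:E | alpha in [set alpha : R |
    (limf_esup (fun rho : R => ereal_sup
       [set x | exists u v,
          [/\ D u /\ D v, ball t0 rho u, ball t0 rho v, u != v &
              x = (`|f u - f v| / `|u - v| `^ alpha)%:E]])
     0^'+ < +oo)%E]].

End Regularity.

Section Martingales.
Context {R : realType} {d : measure_display} {Omega : measurableType d}.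

(* Filtrations, processes and stopping times are only looked at for times in
   R_+. The usual conditions are not imposed, and path properties are required
   almost surely. *)
Implicit Types (P : probability Omega R) (F : R -> set (set Omega)).
Implicit Types (X M A : R -> Omega -> R).

Definition filtration F : Prop :=
  [/\ forall t, 0 <= t -> sigma_algebra setT (F t),
      forall t, 0 <= t -> F t `<=` measurable &
      forall s t, 0 <= s -> s <= t -> F s `<=` F t].

Definition measurable_wrt (G : set (set Omega)) (Y : Omega -> R) : Prop :=
  forall B : set R, measurable B -> G (Y @^-1` B).

Definition adapted F X : Prop := forall t, 0 <= t -> measurable_wrt (F t) (X t).

(* Y is a version of E[Z | G]. *)
Definition is_cond_exp P (G : set (set Omega)) (Z Y : Omega -> R) : Prop :=
  [/\ measurable_wrt G Y, P.-integrable setT (EFin \o Y) &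
      forall B, G B ->
        (\int[P]_(w in B) (Y w)%:E = \int[P]_(w in B) (Z w)%:E)%E].

Definition martingale P F X : Prop :=
  [/\ adapted F X,
      forall t, 0 <= t -> P.-integrable setT (EFin \o X t) &
      forall s t, 0 <= s -> s <= t -> is_cond_exp P (F s) (X t) (X s)].

Definition stopping_time F (T : Omega -> \bar R) : Prop :=
  (forall w, (0 <= T w)%E) /\
  (forall t, 0 <= t -> F t [set w | (T w <= t%:E)%E]).

Definition stopped (T : Omega -> \bar R) X : R -> Omega -> R :=
  fun t w => X (fine (mine t%:E (T w))) w.

(* X 0 is subtracted before localization, so that it need not be integrable. *)
Definition local_martingale P F X : Prop :=
  adapted F X /\
  exists T : nat -> Omega -> \bar R,
    [/\ forall n, stopping_time F (T n),
        {ae P, forall w, nondecreasing_seq (T ^~ w)},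
        {ae P, forall w, T n w @[n --> \oo] --> +oo%E} &
        forall n, martingale P F (fun t w => stopped (T n) X t w - X 0 w)].

Definition continuous_process P X : Prop :=
  {ae P, forall w, {within half_line, continuous (X ^~ w)}}.

Definition continuous_local_martingale P F X : Prop :=
  continuous_process P X /\ local_martingale P F X.

(* A is a version of <M>; it is unique up to indistinguishability. *)
Definition quadratic_variation P F M A : Prop :=
  [/\ adapted F A,
      continuous_process P A,
      {ae P, forall w, A 0 w = 0 /\
        forall s t, 0 <= s -> s <= t -> A s w <= A t w} &
      continuous_local_martingale P F (fun t w => M t w ^+ 2 - A t w)].

End Martingales.

(* Main.v *)
(** Write A for the quadratic variation of M. For each pair of thresholds (mu, g),
    cut the time axis at the successive times where, since the previous cut, M has
    moved by mu or A has grown by g. As M and M^2 - A are martingales after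
    localization, E[(Delta M)^2] = E[Delta A] on every step, conditionally on its
    past. If g = 16 mu^2, a step is therefore ended by A with conditional
    probability at most 1/16, and if g = mu^2/16 it is ended by M with conditional
    probability at most 1/16; the expected number of steps is at most of order
    1/min(g, mu^2). With mu = 2^-n, Borel-Cantelli excludes runs of 2n such steps
    for large n. Pathwise, up to logarithmic factors, |M_v - M_u| is thus at most
    (A_v - A_u)^(1/2), and (A_v - A_u)^(1/2) at most the oscillation of M on
    [u, v]. These two comparisons, uniform in u and v, transfer every increment
    estimate with sigma > 0 between M and A^(1/2). The boundary value
    s' = - alpha only needs that the frontier is nonnegative there, which follows
    from the first Riemann-Liouville integral as sigma tends to 0 from below. *)

Require Import Defs.
From HB Require Import structures.
From mathcomp Require Import all_boot all_order all_algebra.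
From mathcomp Require Import all_classical all_reals all_analysis.
From mathcomp Require Import measurable_realfun.
From mathcomp Require Import zify ring lra.

Set Implicit Arguments.
Unset Strict Implicit.
Unset Printing Implicit Defensive.

Import Order.TTheory GRing.Theory Num.Theory.
Import numFieldNormedType.Exports.

Local Open Scope classical_set_scope.
Local Open Scope ring_scope.

(** * Increment regularity and 2-microlocal exponents *)

Section Increments.
Context {R : realType}.
Implicit Types (x y : R -> R -> R) (t u v s e m : R).

Definition increment_decay x t (sigma s' : R) : Prop :=
  exists C rho : R, [/\ 0 < C, 0 < rho &
    forall u v, half_line u -> half_line v -> ball t rho u -> ball t rho v ->
      u != v ->
      x u v <= C * (`|u - v| `^ sigma) * ((`|u - t| + `|v - t|) `^ (- s'))].

Definition increment_dominated x y t : Prop :=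
  forall e, 0 < e < 1 -> exists C rho : R, [/\ 0 < C, 0 < rho &
    forall u v m, half_line u -> half_line v -> ball t rho u -> ball t rho v ->
      u <= v -> 0 <= m ->
      (forall a b, u <= a <= v -> u <= b <= v -> y a b <= m) ->
      x u v <= C * m `^ (1 - e)].

Definition increment_bounded x t : Prop :=
  exists C rho : R, [/\ 0 < C, 0 < rho &
    forall u v, half_line u -> half_line v -> ball t rho u -> ball t rho v ->
      x u v <= C].

Lemma powR_le2r (p a b : R) : 0 <= p -> 0 <= a -> a <= b -> a `^ p <= b `^ p.
Proof.
move=> p0 a0 ab; apply: ge0_ler_powR => //; rewrite nnegrE//.
exact: le_trans ab.
Qed.

Lemma powRD_gt0 (a p q : R) : 0 < a -> a `^ (p + q) = a `^ p * a `^ q.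
Proof. by move=> a0; rewrite powRD// (gt_eqF a0) implybT. Qed.

Lemma powR_le2r_neg (p a b : R) : p <= 0 -> 0 < a -> a <= b -> b `^ p <= a `^ p.
Proof.
move=> p0 a0 ab; have b0 := lt_le_trans a0 ab.
rewrite -[p]opprK !(powRN _ (- p)) lef_pV2 ?posrE ?powR_gt0//.
by apply: powR_le2r; rewrite ?oppr_ge0// ltW.
Qed.

Lemma ball_half_line_itv t rho u v a :
  half_line u -> ball t rho u -> ball t rho v -> u <= a <= v ->
  half_line a /\ ball t rho a.
Proof.
rewrite /half_line /ball /= => u0 + + /andP[ua av].
rewrite !ltr_distlC => /andP[h1 h2] /andP[h3 h4]; split; first exact: le_trans ua.
by apply/andP; split; [exact: lt_le_trans ua|exact: le_lt_trans h4].
Qed.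

Lemma norm_sub_itv t u v a : u <= a <= v -> `|a - t| <= `|u - t| + `|v - t|.
Proof.
move=> /andP[ua av]; rewrite ler_norml.
have := ler_norm (v - t); have := lerNnormlW (lexx `|u - t|).
have := normr_ge0 (u - t); have := normr_ge0 (v - t); lra.
Qed.

Lemma norm_sub_itv2 t u v a : u <= a <= v -> `|u - t| - (v - u) <= `|a - t|.
Proof.
move=> /andP[ua av]; have : `|u - t| <= `|a - t| + `|u - a|.
  by rewrite (addrC `|a - t|); exact: ler_distD.
by rewrite (ler0_norm (x := u - a)) ?subr_le0//; lra.
Qed.

Lemma norm_sub_itv3 t u v a : u <= a <= v -> `|v - t| - (v - u) <= `|a - t|.
Proof.
move=> /andP[ua av]; have : `|v - t| <= `|a - t| + `|v - a|.
  by rewrite (addrC `|a - t|); exact: ler_distD.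
by rewrite (ger0_norm (x := v - a)) ?subr_ge0//; lra.
Qed.

(* The remaining case, [sigma < s'] with [v - u] comparable to the distance to
   [t], is the one where the bound to be transferred is trivial. *)
Lemma decay_osc (t u v sigma s' a b : R) : 0 < sigma -> u < v ->
  u <= a <= v -> u <= b <= v -> a != b ->
  (sigma < s' -> 4 * (v - u) <= `|u - t| + `|v - t|) ->
  `|a - b| `^ sigma * (`|a - t| + `|b - t|) `^ (- s') <=
  4 `^ `|s'| * ((v - u) `^ sigma * (`|u - t| + `|v - t|) `^ (- s')).
Proof.
move=> s0 uv ha hb ab hs.
set D := `|u - t| + `|v - t|; set E := `|a - t| + `|b - t|.
have d0 : 0 < v - u by rewrite subr_gt0.
have abE : `|a - b| <= E by rewrite /E (distrC b); exact: ler_distD.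
have ab0 : 0 < `|a - b| by rewrite normr_gt0 subr_eq0.
have abd : `|a - b| <= v - u.
  by rewrite ler_norml; move: ha hb => /andP[? ?] /andP[? ?]; lra.
have dD : v - u <= D.
  rewrite -[v - u]gtr0_norm// distrC /D (distrC v); exact: ler_distD.
have E0 : 0 < E := lt_le_trans ab0 abE.
have D0 : 0 < D := lt_le_trans d0 dD.
have [s'0|s'0] := leP s' 0.
  rewrite mulrCA; apply: ler_pM; rewrite ?powR_ge0//.
    by apply: powR_le2r => //; exact: ltW.
  rewrite (ler0_norm s'0) -powRM ?ler0n// ?(ltW D0)//.
  apply: powR_le2r; rewrite ?oppr_ge0// ?(ltW E0)//.
  rewrite /E; have := norm_sub_itv t ha; have := norm_sub_itv t hb.
  by rewrite -/D; lra.
rewrite (gtr0_norm s'0).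
have key : 4 `^ s' * D `^ (- s') = (D / 4) `^ (- s').
  by rewrite powRM ?invr_ge0 ?ler0n ?(ltW D0)// mulrC -powR_inv1 ?ler0n//
    -powRrM mulrN mulN1r opprK.
rewrite mulrCA key.
have [dD4|dD4] := leP (4 * (v - u)) D.
  apply: ler_pM; rewrite ?powR_ge0//.
    by apply: powR_le2r => //; exact: ltW.
  apply: powR_le2r_neg; rewrite ?oppr_le0 ?divr_gt0 ?(ltW s'0)//.
  rewrite /E; have := norm_sub_itv2 t ha; have := norm_sub_itv3 t hb.
  by rewrite /D in dD4 *; move=> *; lra.
have ss : s' <= sigma by rewrite leNgt; apply/negP => /hs; rewrite leNgt dD4.
apply: (@le_trans _ _ ((v - u) `^ sigma * (v - u) `^ (- s'))).
  rewrite -powRD_gt0//.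
  apply: (@le_trans _ _ (`|a - b| `^ (sigma - s'))).
    rewrite (powRD_gt0 _ _ ab0) ler_wpM2l ?powR_ge0//.
    by apply: powR_le2r_neg => //; rewrite oppr_le0 ltW.
  by apply: powR_le2r; rewrite ?subr_ge0 ?(ltW ab0).
rewrite ler_wpM2l ?powR_ge0//.
apply: powR_le2r_neg; rewrite ?oppr_le0 ?divr_gt0 ?(ltW s'0)//.
by rewrite ltW// ltr_pdivrMr// mulrC.
Qed.

Lemma increment_decay_transfer x y t (sigma tau s' : R) :
  (forall u v, x u v = x v u) -> (forall u, y u u = 0) ->
  increment_dominated x y t -> increment_bounded x t ->
  0 <= tau < sigma -> increment_decay y t sigma s' -> increment_decay x t tau s'.
Proof.
move=> xC y0 dom [K [rK [K0 rK0 bK]]] /andP[tau0 tausig] [C1 [r1 [C10 r10 b1]]].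
have sig0 : 0 < sigma := le_lt_trans tau0 tausig.
pose e := (sigma - tau) / (sigma + `|s'| + 1).
have den0 : 0 < sigma + `|s'| + 1 by have := normr_ge0 s'; lra.
have e01 : 0 < e < 1.
  rewrite /e divr_gt0 ?subr_gt0//= ltr_pdivrMr// mul1r.
  by have := normr_ge0 s'; lra.
have e_exp : 0 <= sigma * (1 - e) - tau + e * s'.
  have h : e * (sigma + `|s'| + 1) = sigma - tau.
    by rewrite /e -mulrA mulVf ?mulr1// gt_eqF.
  have h2 : - (e * `|s'|) <= e * s'.
    by rewrite -mulrN ler_pM2l ?lerNnormlW//; case/andP: e01.
  by move/andP: e01 => [? ?]; move: h h2; rewrite !mulrDr; lra.
have e_exp0 : 0 <= sigma * (1 - e) - tau.
  have h : e * (sigma + `|s'| + 1) = sigma - tau.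
    by rewrite /e -mulrA mulVf ?mulr1// gt_eqF.
  have : 0 <= e * `|s'| by rewrite mulr_ge0//; case/andP: e01 => /ltW.
  by move/andP: e01 => [? ?]; move: h; rewrite !mulrDr; lra.
have [C2 [r2 [C20 r20 b2]]] := dom e e01.
pose r := Num.min (Num.min rK r1) (Num.min r2 4^-1).
have rr : [/\ r <= rK, r <= r1, r <= r2 & r <= 4^-1].
  by rewrite /r; split; rewrite !ge_min lexx ?orbT.
case: rr => rrK rr1 rr2 rr4.
have r0 : 0 < r by rewrite /r !lt_min rK0 r10 r20 invr_gt0 ltr0n.
pose m0 := C1 * 4 `^ `|s'|.
have m00 : 0 < m0 by rewrite mulr_gt0// powR_gt0.
pose C3 := C2 * m0 `^ (1 - e).
have C30 : 0 < C3 by rewrite mulr_gt0// powR_gt0.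
exists (Num.max C3 (K * 4 `^ tau)), r; split => //; first by rewrite lt_max C30.
suff H u v : half_line u -> half_line v -> ball t r u -> ball t r v -> u < v ->
    x u v <= Num.max C3 (K * 4 `^ tau) *
      (`|u - v| `^ tau) * ((`|u - t| + `|v - t|) `^ (- s')).
  move=> u v u0 v0 bu bv; rewrite neq_lt => /orP[uv|vu]; first exact: H.
  by rewrite xC distrC (addrC `|u - t|); exact: H.
move=> u0 v0 bu bv uv.
rewrite distrC gtr0_norm ?subr_gt0//.
set D := `|u - t| + `|v - t|.
have d0 : 0 < v - u by rewrite subr_gt0.
have dD : v - u <= D.
  rewrite -[v - u]gtr0_norm// distrC /D (distrC v); exact: ler_distD.
have D0 : 0 < D := lt_le_trans d0 dD.
have D1 : D <= 1.
  move: bu bv; rewrite /ball /= !(distrC t) => bu bv.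
  by rewrite /D; lra.
have sub r' w : r <= r' -> ball t r w -> ball t r' w by move=> ?; exact: le_ball.
have [[ss dD4]|nex] := pselect (sigma < s' /\ D < 4 * (v - u)).
  apply: (@le_trans _ _ K); first by apply: bK => //; exact: sub rrK _.
  apply: (@le_trans _ _ (K * (4 `^ tau * ((v - u) `^ tau * D `^ (- s'))))).
    rewrite ler_peMr ?(ltW K0)//.
    rewrite mulrA -powRM ?ler0n ?(ltW d0)//.
    apply: (@le_trans _ _ (D `^ tau * D `^ (- s'))).
      rewrite -powRD_gt0// -[leLHS](powRr0 D) ger_powR// ?D0//.
      by lra.
    by rewrite ler_wpM2r ?powR_ge0// powR_le2r ?(ltW D0) ?(ltW dD4).
  rewrite -[leRHS]mulrA mulrA ler_wpM2r ?mulr_ge0 ?powR_ge0//.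
  by rewrite le_max lexx orbT.
have yb a b : u <= a <= v -> u <= b <= v ->
    y a b <= m0 * ((v - u) `^ sigma * D `^ (- s')).
  move=> ha hb; have [->|ab] := eqVneq a b.
    by rewrite y0 mulr_ge0 ?mulr_ge0 ?powR_ge0// ltW.
  have [a0 ba] := ball_half_line_itv u0 bu bv ha.
  have [b0 bb] := ball_half_line_itv u0 bu bv hb.
  apply: le_trans (b1 a b a0 b0 (sub _ _ rr1 ba) (sub _ _ rr1 bb) ab) _.
  rewrite /m0 -!mulrA ler_pM2l//; apply: decay_osc => //.
  by move=> ss; rewrite leNgt; apply/negP => dD4; apply: nex.
apply: (le_trans (b2 u v _ u0 v0 (sub _ _ rr2 bu) (sub _ _ rr2 bv) (ltW uv) _ yb)).
  by rewrite mulr_ge0 ?mulr_ge0 ?powR_ge0// ltW.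
rewrite (powRM _ (ltW m00)) ?mulr_ge0 ?powR_ge0// mulrA -/C3.
rewrite -[leRHS]mulrA; apply: ler_pM; rewrite ?powR_ge0 ?(ltW C30)//.
  by rewrite le_max lexx.
rewrite powRM ?powR_ge0// -!powRrM.
have -> : sigma * (1 - e) = tau + (sigma * (1 - e) - tau) by rewrite subrKC.
rewrite powRD_gt0// -mulrA ler_wpM2l ?powR_ge0//.
apply: (@le_trans _ _ (D `^ (sigma * (1 - e) - tau) * D `^ (- s' * (1 - e)))).
  by rewrite ler_wpM2r ?powR_ge0// powR_le2r ?(ltW d0).
rewrite -powRD_gt0// ger_powR ?D0//; lra.
Qed.
End Increments.

Section Exponents.
Context {R : realType}.
Implicit Types (x y : R -> R -> R) (t u v s e m : R) (f g : R -> R).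

Definition absdiff f u v : R := `|f u - f v|.

Definition ball_osc_decay x t (alpha : R) : Prop :=
  exists C rho0 : R, [/\ 0 < C, 0 < rho0 &
    forall rho u v, 0 < rho < rho0 -> half_line u -> half_line v ->
      ball t rho u -> ball t rho v -> x u v <= C * rho `^ alpha].

Definition sup_EFin (S : set R) : \bar R := ereal_sup (EFin @` S).

Lemma half_sup_EFin (S T : set R) : (forall a, S a <-> T (2 * a)) ->
  ((2^-1)%:E * sup_EFin T = sup_EFin S)%E.
Proof.
move=> ST; rewrite /sup_EFin -ereal_sup_pZl ?invr_gt0 ?ltr0n//.
congr ereal_sup; rewrite predeqE => z; split.
  move=> [_ [a Ta <-] <-]; exists (2^-1 * a); last by rewrite EFinM.
  by apply/ST; rewrite mulVKf.
move=> [a /ST Ta <-]; exists (2 * a)%:E; first by exists (2 * a).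
by rewrite -EFinM mulKf.
Qed.

Lemma le_sup_EFin (S T : set R) : (0 <= sup_EFin T)%E ->
  (forall a b, S a -> 0 <= b < a -> T b) -> (sup_EFin S <= sup_EFin T)%E.
Proof.
move=> T0 ST; apply: ge_ereal_sup => _ [a Sa <-].
have [a0|a0] := leP a 0; first by apply: le_trans T0; rewrite lee_fin.
apply/lee_addgt0Pr => e e0.
have [ea|ae] := leP a e.
  by rewrite -[leLHS]add0e leeD// lee_fin.
rewrite -leeBlDr// -EFinB; apply: ereal_sup_ubound; exists (a - e) => //.
by apply: (ST a) => //; rewrite subr_ge0 (ltW ae)/= ltrBlDr ltrDl.
Qed.

Lemma sup_EFin_ge0 (S : set R) : S 0 -> (0 <= sup_EFin S)%E.
Proof. by move=> S0; apply: ereal_sup_ubound; exists 0. Qed.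

Lemma limf_esup_right_ltyP (g : R -> \bar R) :
  (limf_esup g 0^'+ < +oo)%E <->
  exists C rho0 : R, [/\ 0 < C, 0 < rho0 &
    forall rho, 0 < rho < rho0 -> (g rho <= C%:E)%E].
Proof.
split=> [/ereal_inf_lt[_ [V [r /= r0 rV] <-] supV]|[C [r [C0 r0 h]]]].
  have [C C0 hC] : exists2 C : R, 0 < C & (ereal_sup (g @` V) <= C%:E)%E.
    move: supV; case: (ereal_sup _) => [c _| //|_].
      by exists (Num.max 1 c); rewrite ?lt_max ?ltr01// lee_fin le_max lexx orbT.
    by exists 1 => //; rewrite leNye.
  exists C, r; split => // rho /andP[rho0 rhor]; apply: le_trans hC.
  apply: ereal_sup_ubound; exists rho => //; apply: rV => //=.
  by rewrite sub0r normrN gtr0_norm.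
apply: (@le_lt_trans _ _ C%:E); last exact: ltry.
apply: (@le_trans _ _ (ereal_sup (g @` [set rho | 0 < rho < r]))).
  apply: ereal_inf_lbound; exists [set rho | 0 < rho < r] => //.
  exists r => //= z /=; rewrite sub0r normrN => zr z0.
  by rewrite z0/= -(gtr0_norm z0).
by apply: ge_ereal_sup => _ [rho /= hr <-]; exact: h.
Qed.

Lemma pointwise_exponentE f t :
  pseudo_pointwise_exponent half_line f t =
  sup_EFin [set alpha | ball_osc_decay (absdiff f) t alpha].
Proof.
congr ereal_sup; congr (_ @` _); apply/seteqP; split => [a|a] /=.
  move/limf_esup_right_ltyP => [C [r [C0 r0 h]]].
  exists C, r; split => // rho u v hr u0 v0 bu bv.
  have rho0 : 0 < rho by case/andP: hr.
  rewrite -ler_pdivrMr ?powR_gt0//.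
  rewrite -lee_fin; apply: le_trans (h rho hr); apply: ereal_sup_ubound.
  by exists u, v.
move=> [C [r [C0 r0 h]]]; apply/limf_esup_right_ltyP.
exists C, r; split => // rho hr; apply: ge_ereal_sup => _ [u [v [u0 v0 bu bv ->]]].
have rho0 : 0 < rho by case/andP: hr.
by rewrite lee_fin ler_pdivrMr ?powR_gt0//; exact: h.
Qed.

Lemma local_exponentE f t :
  pseudo_local_exponent half_line f t =
  sup_EFin [set alpha | increment_decay (absdiff f) t alpha 0].
Proof.
congr ereal_sup; congr (_ @` _); apply/seteqP; split => [a|a] /=.
  move/limf_esup_right_ltyP => [C [r [C0 r0 h]]].
  exists C, (r / 2); split => //; first by rewrite divr_gt0.
  move=> u v u0 v0 bu bv uv; rewrite oppr0 powRr0 mulr1.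
  rewrite -ler_pdivrMr ?powR_gt0 ?normr_gt0 ?subr_eq0//.
  rewrite -lee_fin; apply: le_trans (h (r / 2) _).
    by apply: ereal_sup_ubound; exists u, v.
  by rewrite divr_gt0//= ltr_pdivrMr// ltr_pMr// ltr1n.
move=> [C [r [C0 r0 h]]]; apply/limf_esup_right_ltyP.
exists C, r; split => // rho /andP[rho0 hr].
apply: ge_ereal_sup => _ [u [v [[u0 v0] bu bv uv ->]]].
have sub w : ball t rho w -> ball t r w by apply: le_ball; exact: ltW.
rewrite lee_fin ler_pdivrMr ?powR_gt0 ?normr_gt0 ?subr_eq0//.
have := h u v u0 v0 (sub _ bu) (sub _ bv) uv.
by rewrite oppr0 powRr0 mulr1.
Qed.

Lemma ball_osc_decay0 x t : increment_bounded x t -> ball_osc_decay x t 0.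
Proof.
move=> [K [r [K0 r0 h]]]; exists K, r; split => // rho u v /andP[_ /ltW hr].
move=> u0 v0 bu bv; rewrite powRr0 mulr1.
by apply: h => //; exact: le_ball bu || exact: le_ball bv.
Qed.

Lemma increment_decay0 x t : increment_bounded x t -> increment_decay x t 0 0.
Proof.
move=> [K [r [K0 r0 h]]]; exists K, r; split => // u v u0 v0 bu bv _.
by rewrite oppr0 !powRr0 !mulr1; exact: h.
Qed.

Lemma ball_osc_decay_transfer x y t (a b : R) :
  (forall u v, x u v = x v u) ->
  increment_dominated x y t -> 0 <= b < a ->
  ball_osc_decay y t a -> ball_osc_decay x t b.
Proof.
move=> xC dom /andP[b0 ba] [C [r [C0 r0 h]]].
have a0 : 0 < a := le_lt_trans b0 ba.
pose e := (a - b) / (a + 1).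
have e01 : 0 < e < 1.
  rewrite /e divr_gt0 ?subr_gt0 ?addr_gt0//= ltr_pdivrMr ?addr_gt0//; lra.
have eb : b <= a * (1 - e).
  have : e * (a + 1) = a - b.
    by rewrite /e -mulrA mulVf ?mulr1// gt_eqF// addr_gt0.
  by move/andP: e01 => [? ?]; lra.
have [C2 [r2 [C20 r20 h2]]] := dom e e01.
pose r3 := Num.min (Num.min r r2) 1.
have rr : [/\ r3 <= r, r3 <= r2 & r3 <= 1].
  by rewrite /r3; split; rewrite !ge_min lexx ?orbT.
case: rr => r3r r3r2 r31.
exists (C2 * C `^ (1 - e)), r3; split.
- by rewrite mulr_gt0 ?powR_gt0.
- by rewrite !lt_min r0 r20/=.
move=> rho u v /andP[rho0 rhor3] u0 v0 bu bv.
wlog uv : u v u0 v0 bu bv / u <= v => [H|].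
  by have [uv|/ltW vu] := leP u v; [exact: H|rewrite xC; exact: H].
have rho1 : rho <= 1 by rewrite (le_trans (ltW rhor3)).
have rr : rho < r by rewrite (lt_le_trans rhor3).
have rr2 : rho <= r2 by rewrite ltW// (lt_le_trans rhor3).
apply: (le_trans (h2 u v (C * rho `^ a) u0 v0 (le_ball rr2 bu) (le_ball rr2 bv) uv _ _)).
- by rewrite mulr_ge0 ?powR_ge0// ltW.
- move=> c d hc hd; have [c0 bc] := ball_half_line_itv u0 bu bv hc.
  have [d0 bd] := ball_half_line_itv u0 bu bv hd.
  by apply: h; rewrite ?rho0.
- rewrite powRM ?powR_ge0 ?(ltW C0)// -powRrM mulrA ler_wpM2l//.
    by rewrite mulr_ge0 ?powR_ge0// ltW.
  by rewrite ger_powR ?rho0.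
Qed.

End Exponents.

Section Frontier.
Context {R : realType}.
Implicit Types (x y : R -> R -> R) (t u v s e m : R) (f g h q : R -> R).
Local Notation mu := (@lebesgue_measure R).

Lemma within_half_line_continuous f : {within half_line, continuous f} ->
  continuous (fun u => f (Num.max u 0)).
Proof.
move=> /subspace_continuousP cf u.
have m0 : half_line (Num.max u 0) by rewrite /half_line /= le_max lexx orbT.
move: (cf _ m0) => /cvgrPdist_lt h; apply/cvgrPdist_lt => e e0.
have /nbhs_ballP[d /= d0 hd] := h e e0.
apply/nbhs_ballP; exists d => // v /= uv; apply: hd; last first.
  by rewrite /half_line /= le_max lexx orbT.
rewrite /ball /=; apply: le_lt_trans uv.
rewrite ler_norml; apply/andP.
case: (leP u 0) => hu; case: (leP v 0) => hv; split; have := ler_norm (u - v);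
  have := lerNnormlW (lexx `|u - v|); have := normr_ge0 (u - v); move=> *; lra.
Qed.

Lemma absdiff_bounded f t : 0 <= t -> continuous (fun u => f (Num.max u 0)) ->
  increment_bounded (absdiff f) t.
Proof.
move=> t0 /(_ t)/cvgrPdist_lt/(_ 1 ltr01)/nbhs_ballP[d /= d0 hd].
exists 2, d; split => // u v u0 v0 bu bv.
have := hd u bu; have := hd v bv; rewrite !max_l// => hv hu.
rewrite /absdiff; apply: (le_trans (ler_distD (f t) _ _)).
by rewrite (distrC (f u)); lra.
Qed.

Lemma half_line_integrable h (a b : R) : 0 <= a ->
  continuous (fun u => h (Num.max u 0)) -> mu.-integrable `[a, b] (EFin \o h).
Proof.
move=> a0 ch.
have := @continuous_compact_integrable _ _ `[a, b]
  (@segment_compact _ a b) (continuous_subspaceT ch).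
apply: eq_integrable => //.
move=> u; rewrite inE /= in_itv/= => /andP[au _].
by rewrite max_l// (le_trans a0).
Qed.

Lemma Rintegral_itv_cat h (a b c : R) : 0 <= a -> a <= b -> b <= c ->
  continuous (fun u => h (Num.max u 0)) ->
  \int[mu]_(r in `[a, c]) h r =
  \int[mu]_(r in `[a, b]) h r + \int[mu]_(r in `[b, c]) h r.
Proof.
move=> a0 ab bc ch.
rewrite -(@Rintegral_itv_obnd_cbnd _ b (BRight c)); last first.
  apply: integrableS (half_line_integrable c (le_trans a0 ab) ch) => //.
  by apply: subset_itvr; rewrite bnd_simp.
by rewrite -(@Rintegral_itvB _ h (BLeft a) (BRight c) b) ?bnd_simp ?subrKC//;
  exact: half_line_integrable.
Qed.

Lemma oriented_int_sub h t u v : 0 <= t -> 0 <= u -> u <= v ->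
  continuous (fun u => h (Num.max u 0)) ->
  oriented_int h t v - oriented_int h t u = \int[mu]_(r in `[u, v]) h r.
Proof.
move=> t0 u0 uv ch; rewrite /oriented_int.
have [tu|ut] := leP t u.
  by rewrite (le_trans tu uv) (Rintegral_itv_cat t0 tu uv ch) addrC addKr.
have [tv|vt] := leP t v.
  by rewrite (Rintegral_itv_cat u0 (ltW ut) tv ch) opprK addrC.
by rewrite (Rintegral_itv_cat u0 uv (ltW vt) ch) opprK addrC addrK.
Qed.

Lemma le_norm_Rintegral_itv h (u v K : R) : 0 <= u -> u <= v ->
  continuous (fun u => h (Num.max u 0)) ->
  (forall r, u <= r <= v -> `|h r| <= K) ->
  `|\int[mu]_(r in `[u, v]) h r| <= K * (v - u).
Proof.
move=> u0 uv ch hK.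
have ih := half_line_integrable v u0 ch.
apply: le_trans (le_normr_Rintegral _ ih) _ => //.
apply: (@le_trans _ _ (\int[mu]_(r in `[u, v]) K)).
  apply: le_Rintegral => //.
  - exact: integrable_abse ih.
  - apply: continuous_compact_integrable; first exact: segment_compact.
    by apply: continuous_subspaceT => z; exact: cvg_cst.
rewrite Rintegral_cst//= lebesgue_measure_itv/= lte_fin.
by case: ltP => //= vu; rewrite mulr0 mulr_ge0 ?subr_ge0//;
  apply: le_trans (hK u _); rewrite ?lexx.
Qed.

Lemma riemann_liouville1 h t u : riemann_liouville 1 t h u = oriented_int h t u.
Proof.
rewrite /riemann_liouville /= invr1 mul1r; congr (oriented_int _ t u).
by apply/funext => r; rewrite expr0 mul1r.
Qed.

Lemma frontier_ge0 f t s' : 0 <= t -> continuous (fun u => f (Num.max u 0)) ->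
  (- pseudo_pointwise_exponent half_line f t <= s'%:E)%E ->
  (0 <= pseudo_frontier half_line f t s')%E.
Proof.
move=> t0 cf as'.
suff key d : 0 < d < 1 -> pseudo_2ml_space half_line t (- d) s' f.
  apply/lee_addgt0Pr => e e0.
  pose d := Num.min e 2^-1.
  have d01 : 0 < d < 1.
    by rewrite lt_min e0 invr_gt0 ltr0n/= gt_min invf_lt1 ?ltr1n// orbT.
  have de : d <= e by rewrite ge_min lexx.
  apply: (@le_trans _ _ ((- d)%:E + e%:E)%E).
    by rewrite -EFinD lee_fin addrC subr_ge0.
  rewrite leeD2r//; apply: ereal_sup_ubound; exists (- d) => //; exact: key.
move=> /andP[d0 d1].
have [a [hda [C [r [C0 r0 hosc]]]]] : exists a, - s' - d < a /\
    ball_osc_decay (absdiff f) t a.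
  have : ((- s' - d)%:E < pseudo_pointwise_exponent half_line f t)%E.
    apply: (@lt_le_trans _ _ (- s')%:E); first by rewrite lte_fin ltrBlDr ltrDl.
    by rewrite EFinN leeNl.
  rewrite pointwise_exponentE => /ereal_sup_gt[_ [a ha <-]].
  by rewrite lte_fin; exists a.
have [b [b0 hdb [C' [r' [C'0 r'0 hosc']]]]] : exists b, [/\ 0 <= b, - s' - d < b &
    ball_osc_decay (absdiff f) t b].
  have [a0|a0] := leP 0 a; first by exists a; split => //; exists C, r.
  exists 0; split => //; first by rewrite (lt_trans hda).
  exact/ball_osc_decay0/absdiff_bounded.
rewrite /pseudo_2ml_space leNgt oppr_lt0 d0/=.
have fd : Num.floor (- d) = -1.
  by apply/eqP; rewrite floor_eq; rewrite mulrN1z; apply/andP; split; lra.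
have -> : `|- Num.floor (- d)|%N = 1%N by rewrite fd.
set h := fun r => f r - f t.
have ch : continuous (fun u => h (Num.max u 0)).
  by move=> u; apply: cvgB; [exact: cf|exact: cvg_cst].
pose r3 := Num.min (r' / 4) 4^-1.
exists (C' * 2 `^ b), r3; split.
- by rewrite mulr_gt0 ?powR_gt0.
- by rewrite /r3 lt_min divr_gt0//= invr_gt0 ltr0n.
rewrite (_ : 1%:R = 1)//.
move=> u v u0 v0 bu bv.
rewrite !riemann_liouville1.
wlog uv : u v u0 v0 bu bv / u < v.
  move=> H; rewrite neq_lt => /orP[uv|vu].
    by apply: H => //; rewrite lt_eqF.
  by rewrite distrC (distrC u) (addrC `|u - t|); apply: H => //; rewrite lt_eqF.
move=> _.
rewrite distrC oriented_int_sub ?(ltW uv)//.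
have duv : 0 < v - u by rewrite subr_gt0.
set D := `|u - t| + `|v - t|.
have dD : v - u <= D.
  rewrite -[v - u]gtr0_norm// distrC /D (distrC v); exact: ler_distD.
have D0 : 0 < D := lt_le_trans duv dD.
move: bu bv; rewrite /ball /= !(distrC t) !lt_min => /andP[bu1 bu2] /andP[bv1 bv2].
have D1 : D <= 1 by rewrite /D; lra.
have hr a' : u <= a' <= v -> `|h a'| <= C' * (2 * D) `^ b.
  move=> ha; have aD := norm_sub_itv t ha.
  have a0 : 0 <= a' by case/andP: ha => ha _; exact: le_trans ha.
  apply: (hosc' (2 * D)) => //.
  - by rewrite mulr_gt0//= /D; lra.
  - by rewrite /ball /= distrC; apply: le_lt_trans aD _; rewrite /D in D0 *; lra.
  - by rewrite /ball /= subrr normr0 mulr_gt0.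
apply: le_trans (le_norm_Rintegral_itv u0 (ltW uv) ch hr) _.
rewrite (distrC u) (gtr0_norm duv) powRM ?(ltW D0)// -!mulrA.
rewrite !ler_pM2l ?powR_gt0//.
have sp : v - u = (v - u) `^ (- d + 1) * (v - u) `^ d.
  by rewrite -powRD_gt0// addrAC addNr add0r powRr1 ?(ltW duv).
rewrite [X in _ * X <= _]sp mulrCA ler_wpM2l ?powR_ge0//.
apply: (@le_trans _ _ (D `^ b * D `^ d)).
  by rewrite ler_wpM2l ?powR_ge0// powR_le2r ?(ltW d0) ?(ltW duv).
rewrite -powRD_gt0// ger_powR ?D0//; lra.
Qed.

Definition sqrt_absdiff q u v : R := Num.sqrt `|q u - q v|.

Lemma absdiffC f u v : absdiff f u v = absdiff f v u.
Proof. exact: distrC. Qed.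

Lemma sqrt_absdiffC q u v : sqrt_absdiff q u v = sqrt_absdiff q v u.
Proof. by rewrite /sqrt_absdiff distrC. Qed.

Lemma powR_double (a p : R) : 0 <= a -> a `^ (2 * p) = (a `^ p) ^+ 2.
Proof. by move=> a0; rewrite mulrC powRrM powR_mulrn ?powR_ge0. Qed.

Lemma sqrt_le_sqr (a b : R) : 0 <= b -> (Num.sqrt a <= b) = (a <= b ^+ 2).
Proof.
by move=> b0; rewrite -(ler_sqrt a (sqr_ge0 b)) sqrtr_sqr ger0_norm.
Qed.

Lemma sqrt_increment_decay q t (sigma s' : R) :
  increment_decay (sqrt_absdiff q) t sigma s' <->
  increment_decay (absdiff q) t (2 * sigma) (2 * s').
Proof.
split => [] [C [r [C0 r0 h]]].
  exists (C ^+ 2), r; split => // [|u v u0 v0 bu bv uv]; first by rewrite exprn_gt0.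
  have := h u v u0 v0 bu bv uv.
  rewrite sqrt_le_sqr ?mulr_ge0 ?powR_ge0 ?(ltW C0)//.
  by rewrite -mulrN !powR_double ?addr_ge0// -!exprMn.
exists (Num.sqrt C), r; split => // [|u v u0 v0 bu bv uv]; first by rewrite sqrtr_gt0.
rewrite sqrt_le_sqr ?mulr_ge0 ?powR_ge0 ?sqrtr_ge0//.
have := h u v u0 v0 bu bv uv.
by rewrite -mulrN !powR_double ?addr_ge0// !exprMn sqr_sqrtr// ltW.
Qed.

Lemma sqrt_ball_osc_decay q t (a : R) :
  ball_osc_decay (sqrt_absdiff q) t a <-> ball_osc_decay (absdiff q) t (2 * a).
Proof.
split => [] [C [r [C0 r0 h]]].
  exists (C ^+ 2), r; split => // [|rho u v hr u0 v0 bu bv].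
    by rewrite exprn_gt0.
  have rho0 : 0 <= rho by case/andP: hr => /ltW.
  have := h rho u v hr u0 v0 bu bv.
  rewrite sqrt_le_sqr ?mulr_ge0 ?powR_ge0 ?(ltW C0)//.
  by rewrite powR_double// -!exprMn.
exists (Num.sqrt C), r; split => // [|rho u v hr u0 v0 bu bv].
  by rewrite sqrtr_gt0.
have rho0 : 0 <= rho by case/andP: hr => /ltW.
rewrite sqrt_le_sqr ?mulr_ge0 ?powR_ge0 ?sqrtr_ge0//.
have := h rho u v hr u0 v0 bu bv.
by rewrite powR_double// !exprMn sqr_sqrtr// ltW.
Qed.

Lemma sqrt_absdiff_bounded q t : increment_bounded (absdiff q) t ->
  increment_bounded (sqrt_absdiff q) t.
Proof.
move=> [K [r [K0 r0 h]]]; exists (Num.sqrt K), r; split => //.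
  by rewrite sqrtr_gt0.
by move=> u v u0 v0 bu bv; rewrite ler_sqrt ?(ltW K0)//; exact: h.
Qed.

Lemma exponents_half f q t : 0 <= t ->
  continuous (fun u => f (Num.max u 0)) -> continuous (fun u => q (Num.max u 0)) ->
  increment_dominated (absdiff f) (sqrt_absdiff q) t ->
  increment_dominated (sqrt_absdiff q) (absdiff f) t ->
  [/\ forall s' : R,
        (- pseudo_pointwise_exponent half_line f t <= s'%:E)%E ->
        (pseudo_frontier half_line f t s' =
         (2^-1)%R%:E * pseudo_frontier half_line q t (2 * s')%R)%E,
      (pseudo_pointwise_exponent half_line f t =
       (2^-1)%R%:E * pseudo_pointwise_exponent half_line q t)%E &
      (pseudo_local_exponent half_line f t =
       (2^-1)%R%:E * pseudo_local_exponent half_line q t)%E].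
Proof.
move=> t0 cf cq fq qf.
have bf := absdiff_bounded t0 cf; have bq := absdiff_bounded t0 cq.
have bsq := sqrt_absdiff_bounded bq.
have f0 u : absdiff f u u = 0 by rewrite /absdiff subrr normr0.
have q0 u : sqrt_absdiff q u u = 0 by rewrite /sqrt_absdiff subrr normr0 sqrtr0.
have pw : (pseudo_pointwise_exponent half_line f t =
       (2^-1)%R%:E * pseudo_pointwise_exponent half_line q t)%E.
  rewrite !pointwise_exponentE.
  rewrite (@half_sup_EFin _ [set a | ball_osc_decay (sqrt_absdiff q) t a]); last first.
    by move=> a; exact: sqrt_ball_osc_decay.
  apply/eqP; rewrite eq_le; apply/andP; split; apply: le_sup_EFin.
  - exact/sup_EFin_ge0/ball_osc_decay0.
  - by move=> a b ha hb; apply: ball_osc_decay_transfer hb ha => //; exact: sqrt_absdiffC.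
  - exact/sup_EFin_ge0/ball_osc_decay0.
  - by move=> a b ha hb; apply: ball_osc_decay_transfer hb ha => //; exact: absdiffC.
split; [|exact: pw|]; last first.
  rewrite !local_exponentE.
  rewrite (@half_sup_EFin _ [set a | increment_decay (sqrt_absdiff q) t a 0]); last first.
    by move=> a; rewrite /= sqrt_increment_decay mulr0.
  apply/eqP; rewrite eq_le; apply/andP; split; apply: le_sup_EFin.
  - exact/sup_EFin_ge0/increment_decay0.
  - move=> a b ha hb; apply: increment_decay_transfer hb ha => //; exact: sqrt_absdiffC.
  - exact/sup_EFin_ge0/increment_decay0.
  - move=> a b ha hb; apply: increment_decay_transfer hb ha => //; exact: absdiffC.
move=> s' hs'.
have fge0 := frontier_ge0 t0 cf hs'.
have qge0 : (0 <= pseudo_frontier half_line q t (2 * s'))%E.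
  apply: frontier_ge0 => //; move: hs'; rewrite pw.
  rewrite -muleN -(@lee_pmul2l _ 2)// muleA -EFinM divff// mul1e -EFinM //.
have pos (g : R -> R) a s : 0 <= a ->
    pseudo_2ml_space half_line t a s g <-> increment_decay (absdiff g) t a s.
  by move=> a0; rewrite /pseudo_2ml_space a0.
pose S := [set a | pseudo_2ml_space half_line t (2 * a) (2 * s') q].
have qS : ((2^-1)%R%:E * pseudo_frontier half_line q t (2 * s')%R = sup_EFin S)%E.
  exact: half_sup_EFin.
have S0 : (0 <= sup_EFin S)%E by rewrite -qS mule_ge0.
rewrite qS; apply/eqP; rewrite eq_le; apply/andP; split; apply: le_sup_EFin => //.
- move=> a b ha /andP[b0 ba]; have a0 := le_trans b0 (ltW ba).
  apply/pos; first by rewrite mulr_ge0.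
  apply/sqrt_increment_decay; move/pos: ha => /(_ a0) ha.
  by apply: increment_decay_transfer ha; rewrite ?b0//; exact: sqrt_absdiffC.
- move=> a b ha /andP[b0 ba]; have a0 := le_trans b0 (ltW ba).
  apply/pos => //.
  move/pos: ha => /(_ (mulr_ge0 (ler0n _ 2) a0))/sqrt_increment_decay ha.
  by apply: increment_decay_transfer ha; rewrite ?b0//; exact: absdiffC.
Qed.

End Frontier.

(** * From dyadic scales to Hoelder-type bounds *)

Section DyadicScales.
Context {R : realType}.

Lemma half_exp_lt (y : R) : 0 < y -> exists n : nat, 2^-1 ^+ n <= y.
Proof.
move=> y0; have [n hn] : exists n : nat, y^-1 < n%:R.
  by exists (Num.truncn y^-1).+1; rewrite truncnS_gt.
exists n; rewrite exprVn -[leRHS]invrK lef_pV2 ?posrE ?exprn_gt0 ?invr_gt0//.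
apply: (le_trans (ltW hn)); rewrite -natrX ler_nat ltnW//; exact: ltn_expl.
Qed.

Lemma linear_le_powR (e : R) : 0 < e ->
  exists2 C : R, 0 < C & forall n : nat, n%:R + 1 <= C * 2 `^ (e * n%:R).
Proof.
move=> e0; have l0 : 0 < e * ln 2 by rewrite mulr_gt0// ln_gt0// ltr1n.
exists (1 + (e * ln 2)^-1) => [|n]; first by rewrite addr_gt0// invr_gt0.
rewrite /powR pnatr_eq0/= mulrAC.
apply: (@le_trans _ _ ((1 + (e * ln 2)^-1) * (1 + e * ln 2 * n%:R))).
  rewrite mulrDl mul1r mulrDr mulr1 mulKf ?gt_eqF//.
  have : 0 <= e * ln 2 * n%:R by rewrite mulr_ge0// ltW.
  have : 0 < (e * ln 2)^-1 by rewrite invr_gt0.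
  lra.
by rewrite ler_wpM2l ?expR_ge1Dx// ltW// addr_gt0// invr_gt0.
Qed.

Lemma powR_of_scales (e K : R) (n0 : nat) : 0 < e < 1 -> 0 < K ->
  exists2 C : R, 0 < C & forall x y : R, 0 <= y -> x <= K ->
    (forall n, (n0 <= n)%N -> y < 2^-1 ^+ n ->
      x <= (8 * n%:R + 8) * 2^-1 ^+ n) ->
    x <= C * y `^ (1 - e).
Proof.
move=> /andP[e0 e1] K0; have e10 : 0 < 1 - e by rewrite subr_gt0.
have [C1 C10 hC1] := linear_le_powR e0.
pose C := Num.max (8 * C1 * 2 `^ (1 - e)) (K * (2 ^+ n0) `^ (1 - e)).
have C0 : 0 < C by rewrite lt_max mulr_gt0 ?powR_gt0// mulr_gt0.
exists C => // x y y0 xK h.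
have pos y' : 0 < y' -> (forall n, (n0 <= n)%N -> y' < 2^-1 ^+ n ->
    x <= (8 * n%:R + 8) * 2^-1 ^+ n) -> x <= C * y' `^ (1 - e).
  move=> {h}y'0 h.
  have [yn0|yn0] := leP (2^-1 ^+ n0) y'.
    apply: (le_trans xK).
    apply: (@le_trans _ _ (K * (2 ^+ n0) `^ (1 - e) * y' `^ (1 - e))); last first.
      by rewrite ler_wpM2r ?powR_ge0// le_max lexx orbT.
    rewrite -mulrA -powRM ?exprn_ge0 ?(ltW y'0)// ler_peMr ?(ltW K0)//.
    apply: (@le_trans _ _ (1 `^ (1 - e))); first by rewrite powR1.
    apply: powR_le2r => //; first exact: ltW.
    by rewrite -ler_pdivrMl ?exprn_gt0// mulr1 -exprVn.
  have [k hk] := half_exp_lt y'0.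
  have ex : exists n, 2^-1 ^+ n.+1 <= y'.
    exists k; apply: le_trans hk; rewrite exprS ler_piMl ?exprn_ge0//.
    by rewrite invf_le1 ?ler1n.
  pose n := ex_minn ex.
  have [hn hmin] : 2^-1 ^+ n.+1 <= y' /\
      forall m, 2^-1 ^+ m.+1 <= y' -> (n <= m)%N.
    by rewrite /n; case: ex_minnP.
  have n0n : (n0 <= n)%N.
    rewrite leqNgt; apply/negP => nn0.
    have : (2^-1 : R) ^+ n0 <= 2^-1 ^+ n.+1.
      by rewrite ler_wiXn2l ?invr_ge0// invf_le1 ?ler1n.
    by move=> /le_trans/(_ hn); rewrite leNgt yn0.
  have yn : y' < 2^-1 ^+ n.
    case E : n => [|m].
      by rewrite expr0 (lt_le_trans yn0)// exprn_ile1 ?invr_ge0// invf_le1 ?ler1n.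
    rewrite ltNge; apply/negP => /hmin; by rewrite E ltnn.
  apply: (le_trans (h n n0n yn)).
  apply: (@le_trans _ _ (8 * C1 * 2 `^ (1 - e) * y' `^ (1 - e))); last first.
    by rewrite ler_wpM2r ?powR_ge0// le_max lexx.
  apply: (@le_trans _ _ (8 * C1 * (2^-1 ^+ n) `^ (1 - e))).
    have -> : 8 * n%:R + 8 = 8 * (n%:R + 1) :> R by rewrite mulrDr mulr1.
    rewrite -!mulrA ler_pM2l//.
    have -> : (2^-1 ^+ n) `^ (1 - e) = 2 `^ (e * n%:R) * 2^-1 ^+ n :> R.
      rewrite exprVn -powR_invn// -powRrM -powRD; last by rewrite pnatr_eq0 implybT.
      by congr (_ `^ _); ring.
    by rewrite mulrA ler_wpM2r ?exprn_ge0 ?invr_ge0.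
  rewrite -!mulrA ler_pM2l// ler_pM2l// -powRM ?(ltW y'0)//.
  apply: powR_le2r; [exact: ltW|by rewrite exprn_ge0 ?invr_ge0|].
  by move: hn; rewrite exprS ler_pdivrMl.
move: y0; rewrite le_eqVlt => /predU1P[y0|y0]; last exact: pos.
rewrite -y0 powR0 ?gt_eqF// mulr0 leNgt; apply/negP => x0.
pose y' := (x / (2 * C)) `^ (1 - e)^-1.
have xC : 0 < x / (2 * C) by rewrite divr_gt0// mulr_gt0.
have : x <= C * y' `^ (1 - e).
  apply: pos; first by rewrite powR_gt0.
  by move=> n nn0 _; apply: h => //; rewrite -y0 exprn_gt0// invr_gt0.
rewrite /y' -powRrM mulVf ?gt_eqF// powRr1 ?(ltW xC)//.
have -> : C * (x / (2 * C)) = x / 2 by field; rewrite gt_eqF.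
lra.
Qed.

End DyadicScales.

Section Steps.
Context {R : realType}.
Variables (f A : R -> R) (rho : nat -> R) (N mu g : R) (I r : nat).
Hypothesis rho0 : rho 0 = 0.
Hypothesis rho_le : forall i, rho i <= rho i.+1.
Hypothesis rhoI : rho I = N.
Hypothesis A_nd : forall s t, 0 <= s -> s <= t -> t <= N -> A s <= A t.
Hypothesis step_le : forall i s, rho i <= s <= rho i.+1 ->
  `|f s - f (rho i)| <= mu /\ A s - A (rho i) <= g.
Hypothesis step_ge : forall i, rho i.+1 < N ->
  mu <= `|f (rho i.+1) - f (rho i)| \/ g <= A (rho i.+1) - A (rho i).

Let rho_mono i j : (i <= j)%N -> rho i <= rho j.
Proof. by move=> ij; apply: (homo_leq (@lexx _ _) (@le_trans _ _)). Qed.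

(* The steps strictly inside [u, v] are all of the type [E], hence fewer than [r]
   of them fit. *)
Lemma few_steps (E : nat -> Prop) (u v : R) : 0 <= u -> u <= v -> v <= N ->
  (forall i, (i < I)%N -> ~ forall j, (j < r)%N -> E (i + j)%N) ->
  (forall i, u <= rho i -> rho i.+1 < v -> E i) ->
  exists p k, [/\ (k <= r.+1)%N, rho p <= u & v <= rho (p + k)%N].
Proof.
move=> u0 uv vN norun hE.
have exu : exists i, u <= rho i by exists I; rewrite rhoI (le_trans uv).
have exv : exists i, v <= rho i by exists I; rewrite rhoI.
pose a := ex_minn exu; pose b := ex_minn exv.
have [ha amin] : u <= rho a /\ forall m, u <= rho m -> (a <= m)%N.
  by rewrite /a; case: ex_minnP.
have [hb bmin] : v <= rho b /\ forall m, v <= rho m -> (b <= m)%N.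
  by rewrite /b; case: ex_minnP.
have bI : (b <= I)%N by apply: bmin; rewrite rhoI.
have bar : (b <= a + r)%N.
  rewrite leqNgt; apply/negP => arb; apply: (norun a).
    by rewrite (leq_trans _ bI)// (leq_ltn_trans _ arb)// leq_addr.
  move=> j jr; apply: hE; first by rewrite (le_trans ha)// rho_mono// leq_addr.
  rewrite ltNge; apply/negP => /bmin; apply/negP; rewrite -ltnNge.
  by rewrite (leq_trans _ arb)// ltnS -addnS leq_add2l.
exists a.-1, (b - a.-1)%N; split.
- by rewrite leq_subLR; move: bar; case: (a) => [|a']; rewrite /= ?addnS// => /leqW.
- case: a amin {ha bar} => [|a'] amin /=; first by rewrite rho0.
  rewrite leNgt; apply/negP => /ltW/amin; by rewrite ltnn.
- by rewrite (le_trans hb)// rho_mono// -leq_subLR.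
Qed.

Lemma many_steps p k s : rho p <= s <= rho (p + k)%N ->
  `|f s - f (rho p)| <= k%:R * mu /\ A s - A (rho p) <= k%:R * g.
Proof.
elim: k s => [|k IH] s.
  rewrite addn0 => /le_anti <-; by rewrite !subrr normr0 !mul0r.
rewrite addnS => /andP[ps sk].
have [sk'|/ltW sk'] := leP s (rho (p + k)%N).
  have [h1 h2] := IH s (introT andP (conj ps sk')).
  have [m0 g0] : 0 <= mu /\ 0 <= g.
    have [] := @step_le 0%N (rho 0); first by rewrite lexx rho_le.
    by rewrite !subrr normr0.
  by split; [apply: le_trans h1 _|apply: le_trans h2 _];
    rewrite ler_wpM2r// ler_nat.
have [|h1 h2] := IH (rho (p + k)%N); first by rewrite lexx rho_mono// leq_addr.
have [|h3 h4] := @step_le (p + k)%N s; first by rewrite sk'.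
rewrite -natr1 !mulrDl !mul1r; split; last by move: h2 h4; lra.
by apply: (le_trans (ler_distD (f (rho (p + k)%N)) _ _)); rewrite addrC lerD.
Qed.

Lemma clock_le_osc (u v : R) : 0 <= u -> u <= v -> v <= N ->
  (forall i, (i < I)%N ->
    ~ forall j, (j < r)%N -> g <= A (rho (i + j).+1) - A (rho (i + j))) ->
  (forall a b, u <= a <= v -> u <= b <= v -> `|f a - f b| < mu) ->
  A v - A u <= r.+1%:R * g.
Proof.
move=> u0 uv vN norun osc.
have [i ui iv|p [k [kr pu vk]]] := @few_steps
  (fun i => g <= A (rho i.+1) - A (rho i)) u v u0 uv vN norun.
  have [|h|//] := @step_ge i; first exact: lt_le_trans iv vN.
  have : `|f (rho i.+1) - f (rho i)| < mu.
    apply: osc; first by rewrite (ltW iv) (le_trans ui)//.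
    by rewrite ui (le_trans _ (ltW iv)).
  by rewrite ltNge h.
have [|_ h] := @many_steps p k v; first by rewrite vk (le_trans pu).
have p0 : 0 <= rho p by rewrite -rho0 rho_mono.
have := A_nd p0 pu (le_trans uv vN).
have g0 : 0 <= g.
  have [] := @step_le 0%N (rho 0); first by rewrite lexx rho_le.
  by rewrite !subrr.
have : k%:R * g <= r.+1%:R * g by rewrite ler_wpM2r// ler_nat.
lra.
Qed.

Lemma osc_le_clock (u v : R) : 0 <= u -> u <= v -> v <= N ->
  (forall i, (i < I)%N ->
    ~ forall j, (j < r)%N -> mu <= `|f (rho (i + j).+1) - f (rho (i + j))|) ->
  A v - A u < g ->
  `|f v - f u| <= 2 * r.+1%:R * mu.
Proof.
move=> u0 uv vN norun Ag.
have [i ui iv|p [k [kr pu vk]]] := @few_steps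
  (fun i => mu <= `|f (rho i.+1) - f (rho i)|) u v u0 uv vN norun.
  have [|//|h] := @step_ge i; first exact: lt_le_trans iv vN.
  have h1 := A_nd (le_trans u0 ui) (rho_le i) (le_trans (ltW iv) vN).
  have := A_nd u0 ui (le_trans (rho_le i) (le_trans (ltW iv) vN)).
  have := A_nd (le_trans u0 (le_trans ui (rho_le i))) (ltW iv) vN.
  lra.
have [|h _] := @many_steps p k v; first by rewrite vk (le_trans pu).
have [|h' _] := @many_steps p k u; first by rewrite pu (le_trans uv).
have m0 : 0 <= mu.
  have [] := @step_le 0%N (rho 0); first by rewrite lexx rho_le.
  by rewrite !subrr normr0.
have km : k%:R * mu <= r.+1%:R * mu by rewrite ler_wpM2r// ler_nat.
apply: (le_trans (ler_distD (f (rho p)) _ _)); rewrite (distrC _ (f u)).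
rewrite -mulrA mulrDl mul1r; lra.
Qed.

End Steps.

(** * Stopping times of continuous adapted processes *)

Section Filtrations.
Context {R : realType} {d : measure_display} {Omega : measurableType d}.
Implicit Types (F : R -> set (set Omega)) (G : set (set Omega)).
Implicit Types (X : R -> Omega -> R) (Y S : Omega -> R).

Definition real_filtration F : Prop :=
  [/\ forall t, sigma_algebra setT (F t), forall t, F t `<=` measurable &
      forall s t, s <= t -> F s `<=` F t].

Definition real_stopping F S : Prop := forall t, F t [set w | S w <= t].

Definition continuous_adapted F X : Prop :=
  (forall t, measurable_wrt (F t) (X t)) /\ forall w, continuous (X ^~ w).

Definition past F S : set (set Omega) :=
  [set B | forall t, F t (B `&` [set w | S w <= t])].

Lemma measurable_wrtP G Y : sigma_algebra setT G ->
  measurable_wrt G Y <->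
  measurable_fun setT (Y : g_sigma_algebraType G -> R).
Proof.
move=> hG; have E := measurable_g_measurableTypeE hG; split => [h _ B mB|h B mB].
  by rewrite setTI E; exact: h.
by have := h measurableT B mB; rewrite setTI E.
Qed.

Section sigma_algebra_closure.
Variable G : set (set Omega).
Hypothesis hG : sigma_algebra setT G.
Let E : @measurable _ (g_sigma_algebraType G) = G := measurable_g_measurableTypeE hG.

Lemma sigma_setT : G setT. Proof. by rewrite -E; exact: measurableT. Qed.
Lemma sigma_set0 : G set0. Proof. by rewrite -E; exact: measurable0. Qed.
Lemma sigma_setC A : G A -> G (~` A).
Proof. rewrite -E; exact: measurableC. Qed.
Lemma sigma_setI A B : G A -> G B -> G (A `&` B).
Proof. rewrite -E; exact: measurableI. Qed.
Lemma sigma_setU A B : G A -> G B -> G (A `|` B).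
Proof. rewrite -E; exact: measurableU. Qed.
Lemma sigma_setD A B : G A -> G B -> G (A `\` B).
Proof. rewrite -E; exact: measurableD. Qed.
Lemma sigma_bigcup (A : nat -> set Omega) : (forall n, G (A n)) -> G (\bigcup_n A n).
Proof. by rewrite -E => h; apply: bigcup_measurable => n _; exact: h. Qed.
Lemma sigma_bigcap (A : nat -> set Omega) : (forall n, G (A n)) -> G (\bigcap_n A n).
Proof. by rewrite -E => h; apply: bigcap_measurable => // n _; exact: h. Qed.
Lemma sigma_bigcup_rat (A : rat -> set Omega) : (forall q, G (A q)) -> G (\bigcup_q A q).
Proof. by rewrite -E => h; exact: bigcupT_measurable_rat. Qed.

Lemma measurable_wrt_le Y : (forall a, G [set w | Y w <= a]) -> measurable_wrt G Y.
Proof.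
move=> h; apply/measurable_wrtP => //.
apply: (measurability _ (RGenOInfty.measurableE R)).
move=> /= _ [_ [x ->] <-]; rewrite setTI E.
rewrite (_ : _ @^-1` _ = ~` [set w | Y w <= x]); first exact: sigma_setC.
by apply/seteqP; split => w /=; rewrite in_itv/= andbT ltNge => /negP.
Qed.

Lemma measurable_wrt_lim (Y_ : nat -> Omega -> R) Y :
  (forall n, measurable_wrt G (Y_ n)) -> (forall w, Y_ ^~ w @ \oo --> Y w) ->
  measurable_wrt G Y.
Proof.
move=> mY cY; apply/measurable_wrtP => //.
apply: (@measurable_fun_cvg _ _ _ _
  (Y_ : nat -> g_sigma_algebraType G -> R)) => [n|w _]; last exact: cY.
exact/measurable_wrtP.
Qed.

End sigma_algebra_closure.

Lemma measurable_wrtS (G G' : set (set Omega)) Y : G `<=` G' ->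
  measurable_wrt G Y -> measurable_wrt G' Y.
Proof. by move=> GG' mY B mB; apply/GG'/mY. Qed.

Lemma measurable_wrt_sub G Y : G `<=` measurable -> measurable_wrt G Y ->
  measurable_fun setT Y.
Proof. by move=> Gm mY _ B mB; rewrite setTI; apply/Gm/mY. Qed.

Lemma truncn_cvg (s : R) : 0 <= s ->
  (Num.truncn (s * n.+1%:R))%:R / n.+1%:R @[n --> \oo] --> s.
Proof.
move=> s0; apply/cvgrPdist_lt => e e0.
near=> n.
have n0 : 0 < n.+1%:R :> R by rewrite ltr0n.
have /andP[h1 h2] : (Num.truncn (s * n.+1%:R))%:R <= s * n.+1%:R <
    (Num.truncn (s * n.+1%:R)).+1%:R by apply: truncn_itv; rewrite mulr_ge0.
have h3 : n.+1%:R^-1 < e by near: n; exact: near_infty_natSinv_lt (PosNum e0).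
have h4 : s < (Num.truncn (s * n.+1%:R))%:R / n.+1%:R + n.+1%:R^-1.
  by rewrite -[X in _ < _ + X]mul1r -mulrDl natr1 ltr_pdivlMr.
have h5 : (Num.truncn (s * n.+1%:R))%:R / n.+1%:R <= s by rewrite ler_pdivrMr.
rewrite ltr_distlC; apply/andP; split.
  by rewrite ltrBlDr (lt_trans h4)// ltrD2l.
by rewrite (le_lt_trans h5)// ltrDl.
Unshelve. all: by end_near.
Qed.

Variable F : R -> set (set Omega).
Hypothesis hF : real_filtration F.

Lemma real_filtration_sigma t : sigma_algebra setT (F t). Proof. by case: hF. Qed.
Let sF := real_filtration_sigma.
Lemma real_filtrationS s t : s <= t -> F s `<=` F t.
Proof. by case: hF => _ _; apply. Qed.
Lemma real_filtration_measurable t : F t `<=` measurable. Proof. by case: hF. Qed.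

Lemma real_stopping_lt S t : real_stopping F S -> F t [set w | S w < t].
Proof.
move=> hS; rewrite (_ : [set _ | _] = \bigcup_n [set w | S w <= t - n.+1%:R^-1]).
  apply: sigma_bigcup => // n.
  apply: (@real_filtrationS (t - n.+1%:R^-1)); last exact: hS.
  by rewrite lerBlDr lerDl invr_ge0.
apply/seteqP; split => w /=.
  move=> St; have tS : 0 < t - S w by rewrite subr_gt0.
  exists (Num.truncn (t - S w)^-1) => //=.
  rewrite lerBrDr -lerBrDl -[leRHS]invrK lef_pV2 ?posrE ?invr_gt0//.
  exact/ltW/truncnS_gt.
by move=> [n _ /= h]; rewrite (le_lt_trans h)// ltrBlDr ltrDl invr_gt0.
Qed.

Lemma min_stopping_wrt S t : real_stopping F S ->
  measurable_wrt (F t) (fun w => Num.min t (S w)).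
Proof.
move=> hS; apply: measurable_wrt_le => // a.
have [ta|at_] := leP t a.
  rewrite (_ : [set _ | _] = setT); first exact: sigma_setT.
  by apply/seteqP; split => w //= _; rewrite ge_min ta.
rewrite (_ : [set _ | _] = [set w | S w <= a]).
  by apply: (@real_filtrationS a); [exact: ltW|exact: hS].
by apply/seteqP; split => w /=; rewrite ge_min leNgt at_.
Qed.

Lemma stopped_wrt X S t : (forall w, 0 <= S w) -> continuous_adapted F X ->
  real_stopping F S -> measurable_wrt (F t) (fun w => X (Num.min t (S w)) w).
Proof.
move=> S0 [aX cX] hS.
have [t0|t0] := ltP t 0.
  rewrite (_ : (fun _ => _) = X t)//; apply/funext => w.
  by rewrite min_l// (le_trans (ltW t0)).
pose S' w := Num.min t (S w).
have S'0 w : 0 <= S' w by rewrite le_min t0 S0.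
apply: (@measurable_wrt_lim _ (sF t) (fun n w =>
    X ((Num.truncn (S' w * n.+1%:R))%:R / n.+1%:R) w)); last first.
  by move=> w; exact: (cvg_comp _ _ (truncn_cvg (S'0 w)) (cX w (S' w))).
move=> n B mB.
rewrite (_ : _ @^-1` _ = \bigcup_k ([set w | Num.truncn (S' w * n.+1%:R) = k] `&`
    X (k%:R / n.+1%:R) @^-1` B)); last first.
  apply/seteqP; split => w /=; first by move=> h; exists (Num.truncn (S' w * n.+1%:R)).
  by move=> [k _ [/= -> ]].
apply: sigma_bigcup => // k.
have mS' : measurable_wrt (F t) S' := min_stopping_wrt t hS.
have e : [set w | Num.truncn (S' w * n.+1%:R) = k] =
    S' @^-1` `[k%:R / n.+1%:R, k.+1%:R / n.+1%:R[%classic.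
  apply/seteqP; split => w /=; rewrite in_itv/= ler_pdivrMr ?ltr0n// ltr_pdivlMr ?ltr0n//.
    by move=> <-; apply: truncn_itv; rewrite mulr_ge0.
  by move=> h; apply/eqP; rewrite truncn_eq// mulr_ge0.
have Fe : F t [set w | Num.truncn (S' w * n.+1%:R) = k] by rewrite e; apply: mS'.
have [kt|tk] := leP (k%:R / n.+1%:R) t.
  by apply: sigma_setI => //; apply: (real_filtrationS kt); exact: aX.
rewrite (_ : _ `&` _ = set0); first exact: sigma_set0.
apply/seteqP; split => w //= -[kE _]; move: tk; apply/negP; rewrite -leNgt -kE.
rewrite ler_pdivrMr ?ltr0n//; apply: (@le_trans _ _ (S' w * n.+1%:R)).
  by case/andP: (truncn_itv (mulr_ge0 (S'0 w) (ler0n R n.+1))).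
by rewrite ler_wpM2r// ge_min lexx.
Qed.


Lemma real_stopping_past_setT S : real_stopping F S -> past F S setT.
Proof. by move=> hS t; rewrite setTI; exact: hS. Qed.

Lemma past_sigma S : real_stopping F S -> sigma_algebra setT (past F S).
Proof.
move=> hS; split.
- by move=> t; rewrite set0I; exact: sigma_set0.
- move=> B hB t.
  rewrite (_ : _ `&` _ = [set w | S w <= t] `\` (B `&` [set w | S w <= t])).
    by apply: sigma_setD.
  apply/seteqP; split => w /=; first by move=> [[_ Bw] St]; split => // -[].
  by move=> [St nB]; split => //; split => // Bw; apply: nB.
- move=> B hB t; rewrite setI_bigcupl; apply: sigma_bigcup => // n; exact: hB.
Qed.

Lemma past_le S S' : (forall w, S w <= S' w) -> real_stopping F S' ->
  past F S `<=` past F S'.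
Proof.
move=> SS' hS' B hB t.
rewrite (_ : _ `&` _ = (B `&` [set w | S w <= t]) `&` [set w | S' w <= t]).
  by apply: sigma_setI.
apply/seteqP; split => w /=; last by case=> -[].
by move=> [Bw S't]; split => //; split => //; exact: le_trans S't.
Qed.

Lemma past_measurable S N : (forall w, S w <= N) -> past F S `<=` measurable.
Proof.
move=> SN B hB; apply: (@real_filtration_measurable N).
rewrite (_ : B = B `&` [set w | S w <= N]); first exact: hB.
by apply/seteqP; split => w //= -[].
Qed.

Lemma stopped_past X S : (forall w, 0 <= S w) -> continuous_adapted F X ->
  real_stopping F S -> measurable_wrt (past F S) (fun w => X (S w) w).
Proof.
move=> S0 hX hS B mB t.
rewrite (_ : _ `&` _ = ((fun w => X (Num.min t (S w)) w) @^-1` B) `&`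
  [set w | S w <= t]); last first.
  by apply/seteqP; split => w /= -[+ St]; rewrite min_r.
by apply: sigma_setI => //; exact: stopped_wrt.
Qed.

Lemma stopped_measurable X S N : (forall w, 0 <= S w <= N) ->
  continuous_adapted F X -> real_stopping F S ->
  measurable_fun setT (fun w => X (S w) w).
Proof.
move=> S0N hX hS; apply: (@measurable_wrt_sub (past F S)).
  by apply: (@past_measurable _ N) => w; case/andP: (S0N w).
by apply: stopped_past => // w; case/andP: (S0N w).
Qed.

Lemma stopped_adapted X S : (forall w, 0 <= S w) -> continuous_adapted F X ->
  real_stopping F S -> continuous_adapted F (fun t w => X (Num.min t (S w)) w).
Proof.
move=> S0 hX hS; split=> [t|w]; first exact: stopped_wrt.
have [_ cX] := hX => t.
have cm : {for t, continuous ((id : R -> R) \min cst (S w))}.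
  by apply: continuous_min; [exact: cvg_id|exact: cvg_cst].
exact: (cvg_comp _ _ cm (cX w _)).
Qed.

Lemma restrict_stopping B S N : (forall w, S w <= N) -> real_stopping F S ->
  past F S B -> real_stopping F (fun w => if w \in B then S w else N).
Proof.
move=> SN hS hB t; have [Nt|tN] := leP N t.
  rewrite (_ : [set _ | _] = setT); first exact: sigma_setT.
  apply/seteqP; split => w //= _; case: ifP => _ //; exact: le_trans Nt.
rewrite (_ : [set _ | _] = B `&` [set w | S w <= t]); first exact: hB.
apply/seteqP; split => w /=.
  by case: ifPn => [/set_mem//|_]; rewrite leNgt tN.
by move=> [Bw St]; rewrite mem_set.
Qed.

Lemma min_stopping S S' : real_stopping F S -> real_stopping F S' ->
  real_stopping F (fun w => Num.min (S w) (S' w)).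
Proof.
move=> hS hS' t.
rewrite (_ : [set _ | _] = [set w | S w <= t] `|` [set w | S' w <= t]).
  by apply: sigma_setU.
apply/seteqP; split => w /=; first by rewrite ge_min => /orP.
by move=> /orP; rewrite ge_min.
Qed.

Lemma cst_stopping N : real_stopping F (fun=> N).
Proof.
move=> t; have [Nt|tN] := leP N t.
  rewrite (_ : [set _ | _] = setT); first exact: sigma_setT.
  by apply/seteqP; split.
rewrite (_ : [set _ | _] = set0); first exact: sigma_set0.
by apply/seteqP; split => w //=; rewrite leNgt tN.
Qed.

Definition hitting (Z : R -> Omega -> R) (N : R) (w : Omega) : R :=
  inf [set s | 0 <= s <= N /\ (1 <= Z s w \/ s = N)].

Section Hitting.
Variables (Z : R -> Omega -> R) (N : R).
Hypothesis N0 : 0 <= N.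
Hypothesis hZ : continuous_adapted F Z.
Let T w := [set s | 0 <= s <= N /\ (1 <= Z s w \/ s = N)].
Let TN w : T w N. Proof. by rewrite /T /= N0 lexx; split => //; right. Qed.
Let Tinf w : has_inf (T w).
Proof. by split; [exists N; exact: TN|exists 0 => s [] /andP[]]. Qed.

Lemma hitting_itv w : 0 <= hitting Z N w <= N.
Proof.
apply/andP; split.
  by apply: lb_le_inf; [exists N; exact: TN|move=> s [] /andP[]].
by apply: ge_inf; [exact: (Tinf w).2|exact: TN].
Qed.

Lemma hitting_lt w s : 0 <= s -> s < hitting Z N w -> Z s w < 1.
Proof.
move=> s0 sH; rewrite ltNge; apply/negP => Zs; move: sH; apply/negP; rewrite -leNgt.
have [sN|Ns] := leP s N.
  by apply: ge_inf; [exact: (Tinf w).2|split; [rewrite s0|left]].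
by apply: le_trans (ltW Ns); case/andP: (hitting_itv w).
Qed.

Lemma hitting_ge w : hitting Z N w < N -> 1 <= Z (hitting Z N w) w.
Proof.
move=> HN; rewrite leNgt; apply/negP => Z1.
have [_ cZ] := hZ.
have /(cvgr_lt _)/(_ 1 Z1)/nbhs_ballP[e /= e0 he] := cZ w (hitting Z N w).
pose e' := Num.min e (N - hitting Z N w).
have e'0 : 0 < e' by rewrite lt_min e0 subr_gt0.
have [s Ts sH] := inf_adherent e'0 (Tinf w).
have Hs : hitting Z N w <= s by apply: ge_inf => //; exact: (Tinf w).2.
have : s < hitting Z N w + e' by [].
rewrite -ltrBlDl lt_min => /andP[h1 h2].
case: Ts => _ [Zs|sN].
  have : Z s w < 1 by apply: he; rewrite /ball /= distrC ger0_norm// subr_ge0.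
  by rewrite ltNge Zs.
by move: h2; rewrite sN ltxx.
Qed.

Lemma hitting_le w s : Z 0 w <= 1 -> 0 <= s <= hitting Z N w -> Z s w <= 1.
Proof.
move=> Z0 /andP[s0]; rewrite le_eqVlt => /predU1P[sH|/hitting_lt/ltW]; last exact.
move: s0; rewrite le_eqVlt => /predU1P[<-//|s0].
rewrite leNgt; apply/negP => Z1; have [_ cZ] := hZ.
have /(cvgr_gt _)/(_ 1 Z1)/nbhs_ballP[e /= e0 he] := cZ w s.
pose r := Num.max 0 (s - e / 2).
have r0 : 0 <= r by rewrite le_max lexx.
have rs : r < s by rewrite gt_max s0/= ltrBlDr ltrDl divr_gt0.
have : Z r w < 1 by apply: hitting_lt => //; rewrite -sH.
rewrite ltNge => /negP; apply; apply/ltW/he.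
rewrite /ball /= gtr0_norm ?subr_gt0// ltrBlDl -ltrBlDr.
by rewrite lt_max; apply/orP; right; rewrite ltrD2l ltrN2 ltr_pdivrMr// ltr_pMr// ltr1n.
Qed.

Lemma hitting_stopping : real_stopping F (hitting Z N).
Proof.
move=> t; have [Nt|tN] := leP N t.
  rewrite (_ : [set _ | _] = setT); first exact: sigma_setT.
  apply/seteqP; split => w //= _; apply: le_trans Nt.
  by case/andP: (hitting_itv w).
have [t0|t0] := ltP t 0.
  rewrite (_ : [set _ | _] = set0); first exact: sigma_set0.
  apply/seteqP; split => w //=; apply/negP; rewrite -ltNge (lt_le_trans t0)//.
  by case/andP: (hitting_itv w).
pose c (q : rat) := Num.min (Num.max 0 (ratr q)) t : R.
have c_itv q : 0 <= c q <= t by rewrite le_min le_max lexx t0 ge_min lexx orbT.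
have [aZ cZ] := hZ.
rewrite (_ : [set _ | _] =
  \bigcap_j \bigcup_q [set w | 1 - j.+1%:R^-1 < Z (c q) w]).
  apply: sigma_bigcap => // j; apply: sigma_bigcup_rat => // q.
  have /andP[_ ct] := c_itv q.
  apply: (real_filtrationS ct).
  rewrite (_ : [set _ | _] = Z (c q) @^-1` `]1 - j.+1%:R^-1, +oo[%classic).
    exact: aZ.
  by apply/seteqP; split => w /=; rewrite in_itv/= andbT.
apply/seteqP; split => w /=.
  move=> Ht j _.
  set H := hitting Z N w in Ht *.
  have HN : H < N := le_lt_trans Ht tN.
  have Z1 : 1 - j.+1%:R^-1 < Z H w.
    by apply: lt_le_trans (hitting_ge HN); rewrite ltrBlDr ltrDl invr_gt0.
  have /(cvgr_gt _)/(_ _ Z1)/nbhs_ballP[e /= e0 he] := cZ w H.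
  have /rat_in_itvoo[q hq] : H - e < H + e by lra.
  exists q => //=; apply: he; rewrite /ball /=.
  have /andP[H0 _] := hitting_itv w; rewrite -/H in H0.
  move: hq; rewrite in_itv/= /c minEle maxEle => /andP[q1 q2].
  rewrite ltr_distlC; apply/andP.
  case: (leP 0 (ratr q : R)) => h1.
    by case: (leP (ratr q : R) t) => h2; split => //; lra.
  by rewrite t0; split; lra.
move=> h; have [s s_in smax] := @EVT_max _ (Z^~ w) 0 t t0
  (continuous_subspaceT (cZ w)).
rewrite in_itv/= in s_in.
have Zs : 1 <= Z s w.
  rewrite leNgt; apply/negP => Zs.
  have [q _ /= hq] := h (Num.truncn (1 - Z s w)^-1) I.
  have := smax (c q); rewrite in_itv/= c_itv => /(_ isT) hc.
  have : 1 - Z s w < (Num.truncn (1 - Z s w)^-1).+1%:R^-1.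
    by rewrite ltrBlDl -ltrBlDr (lt_le_trans hq).
  rewrite -[ltLHS]invrK ltf_pV2 ?posrE ?invr_gt0 ?subr_gt0//.
  by apply/negP; rewrite -leNgt; exact/ltW/truncnS_gt.
case/andP: s_in => s0 st; apply: le_trans (st); apply: ge_inf.
  exact: (Tinf w).2.
by split; [rewrite s0/= ltW// (le_lt_trans st)|left].
Qed.

End Hitting.

End Filtrations.

(** * Optional stopping *)

Section Expectations.
Context {R : realType} {d : measure_display} {Omega : measurableType d}.
Variable P : probability Omega R.
Implicit Types (f h D V : Omega -> R) (G : set (set Omega)).

Lemma bounded_integrable f (K : R) : measurable_fun setT f ->
  (forall w, `|f w| <= K) -> P.-integrable setT (EFin \o f).
Proof.
move=> mf fK; apply: measurable_bounded_integrable => //.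
  exact: (le_lt_trans (probability_le1 P measurableT) (ltry 1)).
by exists K; split; [exact: num_real|move=> x /ltW Kx w _; exact: le_trans Kx].
Qed.

Lemma RintegralS_integrable f (B : set Omega) : measurable B ->
  P.-integrable setT (EFin \o f) -> P.-integrable B (EFin \o f).
Proof. by move=> mB; exact: integrableS. Qed.

Lemma eq_Rintegral_levels (k : Omega -> nat) f h :
  (forall i, measurable [set w | k w = i]) ->
  P.-integrable setT (EFin \o f) -> P.-integrable setT (EFin \o h) ->
  (forall i, \int[P]_(w in [set w | k w = i]) f w =
             \int[P]_(w in [set w | k w = i]) h w) ->
  \int[P]_w f w = \int[P]_w h w.
Proof.
move=> mk intf inth fh.
have cover : \bigcup_i [set w | k w = i] = [set: Omega].
  by apply/seteqP; split => // w _; exists (k w).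
have tI : trivIset setT (fun i => [set w | k w = i]).
  apply/trivIsetP => i j _ _ ij; rewrite -subset0 => w /= [-> /eqP].
  by rewrite (negbTE ij).
rewrite /Rintegral -cover !integral_bigcup ?cover//.
congr fine; apply: eq_eseriesr => i _.
have := fh i; rewrite /Rintegral => e.
rewrite -[LHS]fineK ?e ?fineK//.
- by apply: integrable_fin_num => //; exact: RintegralS_integrable.
- by apply: integrable_fin_num => //; exact: RintegralS_integrable.
Qed.

Lemma Rintegral_mul_measurable_wrt G V D : sigma_algebra setT G ->
  G `<=` measurable -> measurable_wrt G V -> (forall w, 0 <= V w) ->
  P.-integrable setT (EFin \o D) -> P.-integrable setT (EFin \o (V \* D)) ->
  (forall B, G B -> \int[P]_(w in B) D w = 0) ->
  \int[P]_w (V w * D w) = 0.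
Proof.
move=> hG Gm mV V0 iD iVD D0.
pose k (n : nat) w := Num.truncn (V w * n.+1%:R).
pose Vn n w : R := (k n w)%:R / n.+1%:R.
have kE n i : [set w | k n w = i] =
    V @^-1` `[i%:R / n.+1%:R, i.+1%:R / n.+1%:R[%classic.
  apply/seteqP; split => w /=; rewrite in_itv/= ler_pdivrMr// ltr_pdivlMr//.
    by move=> <-; apply: truncn_itv; rewrite mulr_ge0.
  by move=> h; apply/eqP; rewrite truncn_eq// mulr_ge0.
have Gk n i : G [set w | k n w = i] by rewrite kE; exact: mV.
have mVf : measurable_fun setT V := measurable_wrt_sub Gm mV.
have mVn n : measurable_fun setT (Vn n).
  move=> _ B mB; rewrite setTI.
  rewrite (_ : _ @^-1` _ = \bigcup_i ([set w | k n w = i] `&`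
      [set w | B (i%:R / n.+1%:R)])).
    apply: bigcup_measurable => i _; apply: measurableI; first exact/Gm.
    have [h|h] := pselect (B (i%:R / n.+1%:R)).
      by rewrite (_ : [set _ | _] = setT)//; apply/seteqP; split.
    by rewrite (_ : [set _ | _] = set0)//; apply/seteqP; split.
  apply/seteqP; split => w /=; first by move=> h; exists (k n w).
  by move=> [i _ [/= ki]]; rewrite /Vn ki.
have Vn_le n w : 0 <= V w - Vn n w <= n.+1%:R^-1.
  have /andP[h1 h2] := truncn_itv (mulr_ge0 (V0 w) (ler0n R n.+1)).
  rewrite subr_ge0 /Vn ler_pdivrMr// h1/= lerBlDl -[X in _ + X]mul1r -mulrDl natr1.
  by rewrite ler_pdivlMr// ltW.
have Vn_VD n w : `|Vn n w| <= `|V w|.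
  have /andP[] := Vn_le n w; rewrite subr_ge0 => h _.
  by rewrite !ger0_norm// divr_ge0.
have mD : measurable_fun setT D by apply/measurable_EFinP; exact: measurable_int iD.
have iVnD n : P.-integrable setT (EFin \o (Vn n \* D)).
  apply: le_integrable iVD => //.
    by apply/measurable_EFinP; exact: measurable_funM.
  by move=> w _ /=; rewrite lee_fin normrM [leRHS]normrM ler_wpM2r ?Vn_VD.
have Vn0 n : \int[P]_w (Vn n w * D w) = 0.
  transitivity (\int[P]_w (0 : R)); last by rewrite Rintegral_cst// mul0r.
  apply: (@eq_Rintegral_levels (k n)) => //.
  - by move=> i; apply/Gm.
  - exact: iVnD.
  - by apply: (bounded_integrable (K := 0)) => // w /=; rewrite normr0.
  - move=> i; have mi : measurable [set w | k n w = i] by exact/Gm.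
    rewrite Rintegral_cst// mul0r.
    transitivity (\int[P]_(w in [set w | k n w = i]) (i%:R / n.+1%:R * D w)).
      by apply: eq_Rintegral => w /set_mem /= ki; rewrite /Vn ki.
    rewrite RintegralZl//; last exact: RintegralS_integrable.
    by rewrite D0// mulr0.
have key n : `|\int[P]_w (V w * D w)| <= n.+1%:R^-1 * \int[P]_w `|D w|.
  have -> : \int[P]_w (V w * D w) = \int[P]_w ((V w - Vn n w) * D w).
    transitivity (\int[P]_w (V w * D w - Vn n w * D w)).
      have := RintegralB measurableT iVD (iVnD n).
      by rewrite [X in _ - X](_ : _ = 0) ?subr0//; exact: Vn0.
    by apply: eq_Rintegral => w _; rewrite mulrBl.
  have i1 : P.-integrable setT (EFin \o (fun w => (V w - Vn n w) * D w)).
    have := integrableB measurableT iVD (iVnD n); apply: eq_integrable => // w _.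
    by rewrite /= mulrBl EFinB.
  apply: (le_trans (le_normr_Rintegral _ i1)) => //.
  rewrite -RintegralZl//; last exact: integrable_abse iD.
  apply: le_Rintegral => //.
  - exact: integrable_abse i1.
  - exact: (integrableZl measurableT _ (integrable_abse iD)).
  - move=> w _; rewrite normrM ler_wpM2r//.
    by have /andP[h1 h2] := Vn_le n w; rewrite ger0_norm.
apply/eqP; rewrite -normr_le0; apply/ler_addgt0Pr => e e0; rewrite add0r.
set c := \int[P]_w `|D w| in key *.
have c0 : 0 <= c by apply: Rintegral_ge0.
pose n := Num.truncn (c / e).
apply: (le_trans (key n)); rewrite mulrC ler_pdivrMr// mulrC -ler_pdivrMr//.
exact/ltW/truncnS_gt.
Qed.

End Expectations.

Section OptionalStopping.
Context {R : realType} {d : measure_display} {Omega : measurableType d}.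
Variables (P : probability Omega R) (F : R -> set (set Omega)).
Hypothesis hF : real_filtration F.

Definition cont_martingale (W : R -> Omega -> R) : Prop :=
  [/\ continuous_adapted F W,
      forall t, P.-integrable setT (EFin \o W t) &
      forall s t, s <= t -> forall B, F s B ->
        \int[P]_(w in B) W s w = \int[P]_(w in B) W t w].

(* [W] is sampled along a decreasing discretization of [S], but replaced by its
   terminal value where the sample is large: the mean does not change, and
   domination by a constant plus the terminal value becomes available. *)
Lemma optional_stopping W S (N K : R) : cont_martingale W ->
  real_stopping F S -> (forall w, 0 <= S w <= N) ->
  (forall w, `|W (S w) w| <= K) ->
  \int[P]_w W (S w) w = \int[P]_w W 0 w.
Proof.
move=> [hW iW mart] hS SN WK.
have [aW cW] := hW.
have N0 : 0 <= N by have /andP[h1 h2] := SN point; exact: le_trans h2.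
rewrite (@mart 0 (N + 1) _ setT); last exact: sigma_setT (real_filtration_sigma hF 0).
  2: by rewrite addr_ge0.
pose k (n : nat) w := Num.truncn (S w * n.+1%:R).
pose tn (n i : nat) : R := i.+1%:R / n.+1%:R.
pose Z n i w := if `|W (tn n i) w| <= K + 1 then W (tn n i) w else W (N + 1) w.
pose g n w := Z n (k n w) w.
have mW t : measurable_fun setT (W t).
  by apply: measurable_wrt_sub (aW t); exact: real_filtration_measurable.
have FA n i : F (tn n i) [set w | `|W (tn n i) w| <= K + 1].
  rewrite (_ : [set _ | _] = W (tn n i) @^-1` `[- (K + 1), K + 1]%classic).
    exact: aW.
  by apply/seteqP; split => w /=; rewrite in_itv/= ler_norml.
have mZ n i : measurable_fun setT (Z n i).
  apply: measurable_fun_ifT => //.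
  apply: (@measurable_fun_bool _ _ _ _ true); rewrite setTI.
  rewrite (_ : _ @^-1` _ = [set w | `|W (tn n i) w| <= K + 1]) //.
  exact: (real_filtration_measurable hF (FA n i)).
have kE n i : [set w | k n w = i] =
    [set w | S w < tn n i] `\` [set w | S w < i%:R / n.+1%:R].
  apply/seteqP; split => w /=.
    move=> <-; have : 0 <= S w * n.+1%:R by case/andP: (SN w) => h _; rewrite mulr_ge0.
    move=> /truncn_itv/andP[h1 h2]; split; first by rewrite ltr_pdivlMr.
    by apply/negP; rewrite -leNgt ler_pdivrMr.
  move=> [h1 /negP]; rewrite -leNgt => h2; apply: truncn_def.
  by rewrite -ler_pdivrMr// h2 -ltr_pdivlMr.
have Fk n i : F (tn n i) [set w | k n w = i].
  rewrite kE; apply: sigma_setD; first exact: real_filtration_sigma.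
    exact: real_stopping_lt.
  apply: (@real_filtrationS _ _ _ _ hF (i%:R / n.+1%:R)); last exact: real_stopping_lt.
  by rewrite /tn ler_pM2r ?invr_gt0// ler_nat.
have mk n i : measurable [set w | k n w = i].
  exact: (real_filtration_measurable hF (Fk n i)).
have tnN n w : tn n (k n w) <= N + 1.
  have /andP[S0 SwN] := SN w.
  have /truncn_itv/andP[h1 h2] : 0 <= S w * n.+1%:R by rewrite mulr_ge0.
  rewrite /tn -natr1 mulrDl; apply: lerD.
    by rewrite ler_pdivrMr// (le_trans h1)// ler_wpM2r.
  by rewrite mul1r invf_le1// ler1n.
have mg n : measurable_fun setT (g n).
  move=> _ B mB; rewrite setTI.
  rewrite (_ : _ @^-1` _ = \bigcup_i ([set w | k n w = i] `&` Z n i @^-1` B)).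
    apply: bigcup_measurable => i _; apply: measurableI => //.
    by rewrite -[X in measurable X]setTI; exact: mZ.
  apply/seteqP; split => w /=; first by move=> h; exists (k n w).
  by move=> [i _ [/= <-]].
have K0 : 0 <= K := le_trans (normr_ge0 _) (WK point).
have g_le n w : `|g n w| <= (K + 1) + `|W (N + 1) w|.
  rewrite /g /Z; case: ifP => [h|_]; first by rewrite (le_trans h)// lerDl.
  by rewrite lerDr addr_ge0.
have idom : P.-integrable setT (EFin \o (fun w => (K + 1) + `|W (N + 1) w|)).
  apply: (@eq_integrable _ _ _ _ _ _ ((EFin \o cst (K + 1)) \+
    (abse \o (EFin \o W (N + 1))))) => //.
  apply: integrableD => //; last exact: integrable_abse.
  exact: (@bounded_integrable _ _ _ P _ `|K + 1|).
have ig n : P.-integrable setT (EFin \o g n).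
  apply: le_integrable idom => //; first exact/measurable_EFinP.
  move=> w _; rewrite /= lee_fin; apply: (le_trans (g_le n w)).
  exact: ler_norm.
have Eg n : \int[P]_w g n w = \int[P]_w W (N + 1) w.
  apply: (@eq_Rintegral_levels _ _ _ P (k n)) => // i.
  have [tN|Nt] := leP (tn n i) (N + 1); last first.
    rewrite (_ : [set w | _] = set0) ?Rintegral_set0//.
    apply/seteqP; split => w //= ki; move: Nt; apply/negP; rewrite -leNgt -ki.
    exact: tnN.
  transitivity (\int[P]_(w in [set w | k n w = i]) Z n i w).
    by apply: eq_Rintegral => w /set_mem /= ki; rewrite /g ki.
  pose A := [set w | `|W (tn n i) w| <= K + 1].
  pose B1 := [set w | k n w = i] `&` A; pose B2 := [set w | k n w = i] `\` A.
  have FB1 : F (tn n i) B1 by apply: sigma_setI => //; exact: real_filtration_sigma.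
  have FB2 : F (tn n i) B2 by apply: sigma_setD => //; exact: real_filtration_sigma.
  have B12 : [set w | k n w = i] = B1 `|` B2 by rewrite /B1 /B2 setUIDK.
  have mB1 := real_filtration_measurable hF FB1.
  have mB2 := real_filtration_measurable hF FB2.
  have dB : [disjoint B1 & B2].
    by apply/disj_setPS => w [[_ h] [_ h']].
  have iZ : P.-integrable setT (EFin \o Z n i).
    apply: le_integrable idom => //; first exact/measurable_EFinP.
    move=> w _; rewrite /= lee_fin; apply: le_trans (ler_norm _).
    rewrite /Z; case: ifP => [h|_]; first by rewrite (le_trans h)// lerDl.
    by rewrite lerDr addr_ge0.
  rewrite B12 !Rintegral_setU//;
    try by apply: RintegralS_integrable => //; exact: measurableU.
  congr (_ + _).
    rewrite -(mart _ _ tN _ FB1); apply: eq_Rintegral => w /set_mem [_ h].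
    by rewrite /Z; move: h; rewrite /A /= => ->.
  apply: eq_Rintegral => w /set_mem [_ h].
  by rewrite /Z; case: ifP => // h'; exfalso; apply: h.
have cvg_tn w : tn n (k n w) @[n --> \oo] --> S w.
  have /andP[S0 _] := SN w.
  rewrite (_ : (fun n => _) = (fun n => (k n w)%:R / n.+1%:R + n.+1%:R^-1)); last first.
    by apply/funext => n; rewrite /tn -natr1 mulrDl mul1r.
  rewrite -[X in _ --> X]addr0; apply: cvgD; first exact: truncn_cvg.
  exact: cvg_harmonic.
have cvg_g w : g n w @[n --> \oo] --> W (S w) w.
  have h : W (tn n (k n w)) w @[n --> \oo] --> W (S w) w.
    exact: (cvg_comp _ _ (cvg_tn w) (cW w (S w))).
  apply: cvg_trans h; apply: near_eq_cvg.
  have /cvgr_norm_lt : W (tn n (k n w)) w @[n --> \oo] --> W (S w) w.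
    exact: (cvg_comp _ _ (cvg_tn w) (cW w (S w))).
  move=> /(_ (K + 1)); have : `|W (S w) w| < K + 1.
    by rewrite (le_lt_trans (WK w))// ltrDl.
  move=> KK /(_ KK) [n0 _ hn]; exists n0 => // n nn0 /=.
  by rewrite /g /Z ifT// ltW//; exact: hn.
have mWS := stopped_measurable hF SN hW hS.
have mgE n : measurable_fun setT (EFin \o g n) by exact/measurable_EFinP.
have mSE : measurable_fun setT (EFin \o (fun w => W (S w) w)) by exact/measurable_EFinP.
have [||_ _ h] := dominated_convergence measurableT mgE mSE _ idom _.
- by apply: aeW => w _; apply/fine_cvgP; split; [exact: nearW|exact: cvg_g].
- by apply: aeW => w n _; rewrite /= lee_fin.
have {}h : (\int[P]_w W (N + 1) w)%:E @[n --> \oo] -->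
    (\int[P]_w (W (S w) w)%:E)%E.
  apply: cvg_trans h; apply: near_eq_cvg; apply: nearW => n /=.
  rewrite -(Eg n) /Rintegral fineK//.
  exact: (integrable_fin_num measurableT (ig n)).
by rewrite /Rintegral -(cvg_lim _ h)// lim_cst.
Qed.

End OptionalStopping.

(** * Crossings of a bounded martingale and of its clock *)

Section BoundedCore.
Context {R : realType} {d : measure_display} {Omega : measurableType d}.
Variables (P : probability Omega R) (F : R -> set (set Omega)).
Hypothesis hF : real_filtration F.
Let sF t := real_filtration_sigma hF t.

Local Notation prob B := (fine (P B)).

Lemma Rintegral_markov f (B E : set Omega) (a : R) : measurable B -> measurable E ->
  P.-integrable setT (EFin \o f) -> (forall w, 0 <= f w) ->
  (forall w, E w -> a <= f w) -> a * prob (B `&` E) <= \int[P]_(w in B) f w.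
Proof.
move=> mB mE intf f0 aE.
have mBE : measurable (B `&` E) by exact: measurableI.
have mBD : measurable (B `\` E) by exact: measurableD.
have -> : \int[P]_(w in B) f w =
    \int[P]_(w in B `&` E) f w + \int[P]_(w in B `\` E) f w.
  rewrite -Rintegral_setU ?setUIDK//.
    exact: RintegralS_integrable.
  by apply/disj_setPS => w [[_ h] [_ h']].
rewrite -Rintegral_cst// -[leLHS]addr0 lerD ?Rintegral_ge0//.
apply: le_Rintegral => //; try exact: RintegralS_integrable.
  apply: RintegralS_integrable => //.
  by apply: (@bounded_integrable _ _ _ P _ `|a|).
by move=> w [_ Ew]; exact: aE.
Qed.

Lemma Rintegral_le_cst f (B : set Omega) (c : R) : measurable B ->
  P.-integrable setT (EFin \o f) -> (forall w, f w <= c) ->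
  \int[P]_(w in B) f w <= c * prob B.
Proof.
move=> mB intf fc; rewrite -Rintegral_cst//.
apply: le_Rintegral => //; first exact: RintegralS_integrable.
apply: RintegralS_integrable => //.
by apply: (@bounded_integrable _ _ _ P _ `|c|).
Qed.

Lemma measurable_wrt_comp (G : set (set Omega)) (Y : Omega -> R) (h : R -> R) :
  measurable_fun setT h -> measurable_wrt G Y -> measurable_wrt G (h \o Y).
Proof.
move=> mh mY B mB; rewrite comp_preimage; apply: mY.
by rewrite -[X in measurable X]setTI; exact: mh.
Qed.

Section mean_increments.
Variables (Y : R -> Omega -> R) (N K : R).
Hypothesis hY : continuous_adapted F Y.
Hypothesis YK : forall t w, `|Y t w| <= K.
Hypothesis mean_Y : forall S, real_stopping F S -> (forall w, 0 <= S w <= N) ->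
  \int[P]_w Y (S w) w = \int[P]_w Y 0 w.

Lemma stopped_integrable S : real_stopping F S -> (forall w, 0 <= S w <= N) ->
  P.-integrable setT (EFin \o (fun w => Y (S w) w)).
Proof.
by move=> hS SN; apply: (@bounded_integrable _ _ _ P _ K) => //;
  exact: (stopped_measurable hF SN).
Qed.

(* Stop at [N] instead of [S] or [S'] off [B], and subtract the two means. *)
Lemma mean_increment_past S S' B : real_stopping F S -> real_stopping F S' ->
  (forall w, 0 <= S w) -> (forall w, S w <= S' w) -> (forall w, S' w <= N) ->
  past F S B -> \int[P]_(w in B) (Y (S' w) w - Y (S w) w) = 0.
Proof.
move=> hS hS' S0 SS' S'N BS.
have S'0 w : 0 <= S' w := le_trans (S0 w) (SS' w).
have SN w : S w <= N := le_trans (SS' w) (S'N w).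
have BS' : past F S' B := past_le hF SS' hS' BS.
pose SB w := if w \in B then S w else N.
pose SB' w := if w \in B then S' w else N.
have hSB : real_stopping F SB := restrict_stopping hF SN hS BS.
have hSB' : real_stopping F SB' := restrict_stopping hF S'N hS' BS'.
have SBN w : 0 <= SB w <= N.
  by rewrite /SB; case: ifP; rewrite ?S0 ?SN// lexx (le_trans (S0 w)).
have SBN' w : 0 <= SB' w <= N.
  by rewrite /SB'; case: ifP; rewrite ?S'0 ?S'N// lexx (le_trans (S0 w)).
rewrite Rintegral_mkcond.
transitivity (\int[P]_w (Y (SB' w) w - Y (SB w) w)).
  apply: eq_Rintegral => w _; rewrite patchE /SB /SB'.
  by case: ifP => // _; rewrite subrr.
have := RintegralB measurableT (stopped_integrable hSB' SBN')
  (stopped_integrable hSB SBN).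
move=> /= ->; apply/eqP; rewrite subr_eq0; apply/eqP.
by rewrite [LHS]mean_Y// [RHS]mean_Y.
Qed.
End mean_increments.

Variables (X A : R -> Omega -> R) (N K : R).
Hypotheses (N0 : 0 <= N) (K0 : 0 <= K).
Hypothesis hX : continuous_adapted F X.
Hypothesis hA : continuous_adapted F A.
Hypothesis XK : forall t w, `|X t w| <= K.
Hypothesis AK : forall t w, 0 <= A t w <= K.
Hypothesis A_nd : forall w s t, s <= t -> A s w <= A t w.
Hypothesis mean_X : forall S, real_stopping F S -> (forall w, 0 <= S w <= N) ->
  \int[P]_w X (S w) w = \int[P]_w X 0 w.
Hypothesis mean_Q : forall S, real_stopping F S -> (forall w, 0 <= S w <= N) ->
  \int[P]_w (X (S w) w ^+ 2 - A (S w) w) = \int[P]_w (X 0 w ^+ 2 - A 0 w).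

Let Q t w := X t w ^+ 2 - A t w.

Let QK t w : `|Q t w| <= K ^+ 2 + K.
Proof.
rewrite /Q; apply: (le_trans (ler_normB _ _)); apply: lerD.
  by rewrite normrX lerXn2r ?nnegrE.
by have /andP[h1 h2] := AK t w; rewrite ger0_norm.
Qed.

Let AK' t w : `|A t w| <= K.
Proof. by have /andP[h1 h2] := AK t w; rewrite ger0_norm. Qed.

Let hQ : continuous_adapted F Q.
Proof.
have [aX cX] := hX; have [aA cA] := hA; split => [t|w t].
  apply/(measurable_wrtP _ (sF t)); apply: measurable_funB.
    by apply: measurable_funX; apply/(measurable_wrtP _ (sF t)).
  by apply/(measurable_wrtP _ (sF t)).
by apply: cvgB; [rewrite /=; under eq_fun do rewrite expr2;
  rewrite expr2; apply: cvgM; exact: cX|exact: cA].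
Qed.

Section one_step.
Variables S S' : Omega -> R.
Hypotheses (hS : real_stopping F S) (hS' : real_stopping F S').
Hypotheses (S0 : forall w, 0 <= S w) (SS' : forall w, S w <= S' w).
Hypothesis S'N : forall w, S' w <= N.
Let DX w := X (S' w) w - X (S w) w.
Let DA w := A (S' w) w - A (S w) w.
Let S'0 w : 0 <= S' w <= N.
Proof. by rewrite S'N (le_trans (S0 w)). Qed.
Let SN w : 0 <= S w <= N.
Proof. by rewrite S0 (le_trans (SS' w)). Qed.

Let DA0 w : 0 <= DA w. Proof. by rewrite subr_ge0 A_nd. Qed.

Lemma DX_measurable : measurable_fun setT DX.
Proof.
by apply: measurable_funB; [exact: (stopped_measurable hF S'0)|
  exact: (stopped_measurable hF SN)].
Qed.

Lemma DA_measurable : measurable_fun setT DA.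
Proof.
by apply: measurable_funB; [exact: (stopped_measurable hF S'0)|
  exact: (stopped_measurable hF SN)].
Qed.

Let DXK w : `|DX w| <= 2 * K.
Proof. by rewrite (le_trans (ler_normB _ _))// mulr2n mulrDl mul1r lerD. Qed.

Lemma DA_integrable : P.-integrable setT (EFin \o DA).
Proof.
apply: (@bounded_integrable _ _ _ P _ (2 * K)); first exact: DA_measurable.
by move=> w; rewrite (le_trans (ler_normB _ _))// mulr2n mulrDl mul1r lerD.
Qed.

Lemma DX2_integrable : P.-integrable setT (EFin \o (fun w => DX w ^+ 2)).
Proof.
apply: (@bounded_integrable _ _ _ P _ ((2 * K) ^+ 2)).
  by apply: measurable_funX; exact: DX_measurable.
by move=> w; rewrite normrX lerXn2r ?nnegrE// mulr_ge0.
Qed.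

Lemma mean_square_increment B : past F S B ->
  \int[P]_(w in B) DX w ^+ 2 = \int[P]_(w in B) DA w.
Proof.
move=> BS.
have pS := past_sigma hF hS.
have pSm : past F S `<=` measurable.
  by apply: (@past_measurable _ _ _ _ hF S N) => w; case/andP: (SN w).
have mB := pSm _ BS.
have mXS := stopped_measurable hF SN hX hS.
pose V w := X (S w) w + K.
have V0 w : 0 <= V w.
  by rewrite /V; have := lerNnormlW (XK (S w) w); lra.
have mV : measurable_wrt (past F S) V.
  apply: (@measurable_wrt_comp _ (fun w => X (S w) w) (fun x => x + K)).
    exact: measurable_funD.
  exact: stopped_past.
have mDB : measurable_fun setT (DX \_ B).
  by apply/(measurable_restrictT _ mB); apply: measurable_funS DX_measurable.
have DXBK w : `|(DX \_ B) w| <= 2 * K.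
  by rewrite patchE; case: ifP => // _; rewrite normr0 mulr_ge0.
have VK w : `|V w| <= 2 * K.
  by rewrite (le_trans (ler_normD _ _))// mulr2n mulrDl mul1r lerD ?(ger0_norm K0).
have iDB : P.-integrable setT (EFin \o (DX \_ B)).
  exact: (@bounded_integrable _ _ _ P _ (2 * K)).
have mVf : measurable_fun setT V := measurable_wrt_sub pSm mV.
have iVDB : P.-integrable setT (EFin \o (V \* (DX \_ B))).
  apply: (@bounded_integrable _ _ _ P _ ((2 * K) ^+ 2)); first exact: measurable_funM.
  by move=> w; rewrite normrM expr2 ler_pM.
have VDB : \int[P]_w (V w * (DX \_ B) w) = 0.
  apply: (@Rintegral_mul_measurable_wrt _ _ _ P (past F S)) => // B' B'S.
  rewrite -Rintegral_mkcondr.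
  apply: (mean_increment_past (Y := X) (N := N) (K := K)) => //.
  exact: (sigma_setI pS).
have DB0 : \int[P]_w (DX \_ B) w = 0.
  rewrite -Rintegral_mkcond.
  exact: (mean_increment_past (Y := X) (N := N) (K := K)).
have Q0 : \int[P]_w ((fun w => Q (S' w) w - Q (S w) w) \_ B) w = 0.
  rewrite -Rintegral_mkcond.
  exact: (mean_increment_past (Y := Q) (N := N) (K := K ^+ 2 + K)).
pose U w := (Q (S' w) w - Q (S w) w).
have iU : P.-integrable setT (EFin \o (U \_ B)).
  apply: (@bounded_integrable _ _ _ P _ (2 * (K ^+ 2 + K))).
    apply/(measurable_restrictT _ mB).
    apply: (@measurable_funS _ _ _ _ setT) => //.
    by apply: measurable_funB; [exact: (stopped_measurable hF S'0)|
      exact: (stopped_measurable hF SN)].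
  have K2 : 0 <= K ^+ 2 + K by rewrite addr_ge0// exprn_ge0.
  move=> w; rewrite patchE; case: ifP => _; last by rewrite normr0 mulr_ge0.
  by rewrite (le_trans (ler_normB _ _))// mulr2n mulrDl mul1r lerD.
have iDX2 := DX2_integrable; have iDA := DA_integrable.
apply/eqP; rewrite -subr_eq0.
have <- : \int[P]_(w in B) (DX w ^+ 2 - DA w) =
    \int[P]_(w in B) DX w ^+ 2 - \int[P]_(w in B) DA w.
  by rewrite RintegralB//; exact: RintegralS_integrable.
apply/eqP; rewrite Rintegral_mkcond.
have i2 : P.-integrable setT (EFin \o (fun w => (- 2) * (V w * (DX \_ B) w))).
  exact: (integrableZl measurableT (- 2) iVDB).
have i3 : P.-integrable setT (EFin \o (fun w => (2 * K) * (DX \_ B) w)).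
  exact: (integrableZl measurableT (2 * K) iDB).
transitivity (\int[P]_w ((U \_ B) w +
    ((- 2) * (V w * (DX \_ B) w) + (2 * K) * (DX \_ B) w))).
  apply: eq_Rintegral => w _; rewrite !patchE; case: ifP => _; last first.
    by rewrite !mulr0 !addr0.
  rewrite /U /Q /V /DX /DA; ring.
have i23 := integrableD measurableT i2 i3.
rewrite (RintegralD measurableT iU i23) (RintegralD measurableT i2 i3).
rewrite [X in X + _]Q0 (RintegralZl _ _ iVDB)// VDB (RintegralZl _ _ iDB)// DB0.
by rewrite !mulr0 !addr0.
Qed.

Variables mu g : R.
Hypotheses (mu0 : 0 < mu) (g0 : 0 < g).
Hypothesis DXmu : forall w, `|DX w| <= mu.
Hypothesis DAg : forall w, DA w <= g.

Let pSm : past F S `<=` measurable.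
Proof. by apply: (@past_measurable _ _ _ _ hF S N) => w; case/andP: (SN w). Qed.

Lemma clock_step_measurable : past F S' [set w | g <= DA w].
Proof.
have pS' := past_sigma hF hS'.
have m : measurable_wrt (past F S') DA.
  apply/(measurable_wrtP _ pS'); apply: measurable_funB; apply/(measurable_wrtP _ pS').
    by apply: stopped_past => // w; case/andP: (S'0 w).
  by apply: (measurable_wrtS (past_le hF SS' hS')); exact: stopped_past.
rewrite (_ : [set w | _] = DA @^-1` `[g, +oo[%classic); first exact: m.
by apply/seteqP; split => w /=; rewrite in_itv/= andbT.
Qed.

Lemma space_step_measurable : past F S' [set w | mu <= `|DX w|].
Proof.
have pS' := past_sigma hF hS'.
have m : measurable_wrt (past F S') DX.
  apply/(measurable_wrtP _ pS'); apply: measurable_funB; apply/(measurable_wrtP _ pS').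
    by apply: stopped_past => // w; case/andP: (S'0 w).
  by apply: (measurable_wrtS (past_le hF SS' hS')); exact: stopped_past.
rewrite (_ : [set w | _] = ((fun x : R => `|x|) \o DX) @^-1` `[mu, +oo[%classic).
  by apply: (measurable_wrt_comp _ m) => //; exact: normr_measurable.
by apply/seteqP; split => w /=; rewrite in_itv/= andbT.
Qed.

Let pS'm : past F S' `<=` measurable.
Proof. exact: (@past_measurable _ _ _ _ hF S' N). Qed.

Lemma prob_clock_step B : past F S B ->
  prob (B `&` [set w | g <= DA w]) <= mu ^+ 2 / g * prob B.
Proof.
move=> BS; rewrite mulrAC ler_pdivlMr// mulrC.
apply: (le_trans (@Rintegral_markov DA _ _ g _ _ _ _ _)) => //.
- exact: pSm.
- exact/pS'm/clock_step_measurable.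
- exact: DA_integrable.
rewrite -mean_square_increment//; apply: Rintegral_le_cst; first exact: pSm.
  exact: DX2_integrable.
by move=> w; rewrite -[leLHS]real_normK ?num_real// lerXn2r ?nnegrE// ltW.
Qed.

Lemma prob_space_step B : past F S B ->
  prob (B `&` [set w | mu <= `|DX w|]) <= g / mu ^+ 2 * prob B.
Proof.
move=> BS; rewrite mulrAC ler_pdivlMr ?exprn_gt0// mulrC.
apply: (le_trans (@Rintegral_markov (fun w => DX w ^+ 2) _ _ (mu ^+ 2) _ _ _ _ _)).
- exact: pSm.
- exact/pS'm/space_step_measurable.
- exact: DX2_integrable.
- by move=> w; exact: sqr_ge0.
- by move=> w /= h; rewrite -[leRHS]real_normK ?num_real// lerXn2r ?nnegrE// ltW.
rewrite mean_square_increment//; apply: Rintegral_le_cst => //; first exact: pSm.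
exact: DA_integrable.
Qed.

Lemma prob_not_last (m : R) : 0 < m -> m <= g -> m <= mu ^+ 2 ->
  (forall w, S' w < N -> mu <= `|DX w| \/ g <= DA w) ->
  m * prob [set w | S' w < N] <=
  2 * (\int[P]_w A (S' w) w - \int[P]_w A (S w) w).
Proof.
move=> m0 mg mmu hlast.
have iS' := stopped_integrable hA AK' hS' S'0.
have iS := stopped_integrable hA AK' hS SN.
have EDA : \int[P]_w DA w = \int[P]_w A (S' w) w - \int[P]_w A (S w) w.
  exact: RintegralB.
have isum : P.-integrable setT (EFin \o (fun w => DA w + DX w ^+ 2)).
  exact: (integrableD measurableT DA_integrable DX2_integrable).
have Esum : \int[P]_w (DA w + DX w ^+ 2) = 2 * \int[P]_w DA w.
  rewrite (RintegralD measurableT DA_integrable DX2_integrable).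
  rewrite mean_square_increment; first by rewrite mulr2n mulrDl mul1r.
  exact: real_stopping_past_setT.
rewrite -EDA -Esum -[X in P X]setTI; apply: Rintegral_markov => //.
- apply: (real_filtration_measurable hF (t := N)).
  exact: real_stopping_lt.
- by move=> w; rewrite addr_ge0// sqr_ge0.
- move=> w /= /hlast[h|h].
    rewrite -[m]add0r lerD// (le_trans mmu)// -[leRHS]real_normK ?num_real//.
    rewrite lerXn2r ?nnegrE//.
    exact: ltW.
  by rewrite -[m]addr0 lerD// ?sqr_ge0// (le_trans mg).
Qed.

End one_step.

End BoundedCore.

Section Crossings.
Context {R : realType} {d : measure_display} {Omega : measurableType d}.
Variables (P : probability Omega R) (F : R -> set (set Omega)).
Hypothesis hF : real_filtration F.
Let sF t := real_filtration_sigma hF t.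

Local Notation prob B := (fine (P B)).

Variables (X A : R -> Omega -> R) (N K : R).
Hypotheses (N0 : 0 <= N) (K0 : 0 <= K).
Hypothesis hX : continuous_adapted F X.
Hypothesis hA : continuous_adapted F A.
Hypothesis XK : forall t w, `|X t w| <= K.
Hypothesis AK : forall t w, 0 <= A t w <= K.
Hypothesis A_nd : forall w s t, s <= t -> A s w <= A t w.
Hypothesis mean_X : forall S, real_stopping F S -> (forall w, 0 <= S w <= N) ->
  \int[P]_w X (S w) w = \int[P]_w X 0 w.
Hypothesis mean_Q : forall S, real_stopping F S -> (forall w, 0 <= S w <= N) ->
  \int[P]_w (X (S w) w ^+ 2 - A (S w) w) = \int[P]_w (X 0 w ^+ 2 - A 0 w).

Section fixed_scale.
Variables mu g : R.
Hypotheses (mu0 : 0 < mu) (g0 : 0 < g).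

Definition travel (S : Omega -> R) (t : R) (w : Omega) : R :=
  Num.max (`|X t w - X (Num.min t (S w)) w| / mu)
          ((A t w - A (Num.min t (S w)) w) / g).

Fixpoint crossing (i : nat) : Omega -> R :=
  if i is j.+1 then hitting (travel (crossing j)) N else fun=> 0.

Arguments crossing : simpl never.

Lemma travel_adapted S : (forall w, 0 <= S w) -> real_stopping F S ->
  continuous_adapted F (travel S).
Proof.
move=> S0 hS.
have [aX cX] := hX; have [aA cA] := hA.
have [aXS cXS] := stopped_adapted hF S0 hX hS.
have [aAS cAS] := stopped_adapted hF S0 hA hS.
split => [t|w t].
  apply/(measurable_wrtP _ (sF t)); apply: measurable_maxr.
    apply: measurable_funM => //; apply: measurableT_comp => //.
    by apply: measurable_funB; apply/(measurable_wrtP _ (sF t)).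
  by apply: measurable_funM => //; apply: measurable_funB;
    apply/(measurable_wrtP _ (sF t)).
have c1 : {for t, continuous (fun t => `|X t w - X (Num.min t (S w)) w| / mu)}.
  apply: cvgM; last exact: cvg_cst.
  by apply: cvg_norm; apply: cvgB; [exact: cX|exact: cXS].
have c2 : {for t, continuous (fun t => (A t w - A (Num.min t (S w)) w) / g)}.
  apply: cvgM; last exact: cvg_cst.
  by apply: cvgB; [exact: cA|exact: cAS].
exact: (continuous_max c1 c2).
Qed.

Lemma crossing_stopping i :
  real_stopping F (crossing i) /\ forall w, 0 <= crossing i w <= N.
Proof.
elim: i => [|i [hS SN]]; first by split => [|w]; [exact: cst_stopping|rewrite lexx].
have S0 w : 0 <= crossing i w by case/andP: (SN w).
split => [|w]; last exact: hitting_itv.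
by apply: hitting_stopping => //; exact: travel_adapted.
Qed.

Let rS i : real_stopping F (crossing i) := (crossing_stopping i).1.
Let rN i w : 0 <= crossing i w <= N := (crossing_stopping i).2 w.
Let r0 i w : 0 <= crossing i w. Proof. by case/andP: (rN i w). Qed.
Let rleN i w : crossing i w <= N. Proof. by case/andP: (rN i w). Qed.
Let hZ i := travel_adapted (r0 i) (rS i).

Lemma travel_before S t w : t <= S w -> travel S t w = 0.
Proof. by move=> tS; rewrite /travel min_l// !subrr normr0 !mul0r maxxx. Qed.

Lemma crossing_le i w : crossing i w <= crossing i.+1 w.
Proof.
rewrite leNgt; apply/negP => h.
have := hitting_ge N0 (hZ i) (lt_le_trans h (rleN i w)).
by rewrite -/(crossing i.+1 w) travel_before ?(ltW h)// ler10.
Qed.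

Lemma crossing_mono i j w : (i <= j)%N -> crossing i w <= crossing j w.
Proof.
move=> ij; apply: (homo_leq (f := crossing ^~ w) (@lexx _ _) (@le_trans _ _)) => //.
by move=> k; exact: crossing_le.
Qed.

Lemma crossing_within i s w : crossing i w <= s <= crossing i.+1 w ->
  `|X s w - X (crossing i w) w| <= mu /\ A s w - A (crossing i w) w <= g.
Proof.
move=> /andP[is_ si].
have : travel (crossing i) s w <= 1.
  apply: (hitting_le N0 (hZ i)); first by rewrite travel_before.
  by rewrite (le_trans (r0 i w) is_).
by rewrite /travel min_r// ge_max !ler_pdivrMr// !mul1r => /andP[].
Qed.

Lemma crossing_reached i w : crossing i.+1 w < N ->
  mu <= `|X (crossing i.+1 w) w - X (crossing i w) w| \/
  g <= A (crossing i.+1 w) w - A (crossing i w) w.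
Proof.
move=> iN; have := hitting_ge N0 (hZ i) iN.
rewrite -/(crossing i.+1 w) /travel min_r ?crossing_le//.
by rewrite le_max !ler_pdivlMr// !mul1r => /orP.
Qed.

Lemma prob_crossing_lt (m : R) (n : nat) : 0 < m -> m <= g -> m <= mu ^+ 2 ->
  n%:R * m * prob [set w | crossing n w < N] <= 2 * K.
Proof.
move=> m0 mg mmu.
have mcr i : measurable [set w | crossing i w < N].
  by apply: (real_filtration_measurable hF (t := N)); exact: real_stopping_lt.
have key k : (k <= n)%N -> k%:R * m * prob [set w | crossing n w < N] <=
    2 * (\int[P]_w A (crossing k w) w - \int[P]_w A 0 w).
  elim: k => [_|k IH kn]; first by rewrite !mul0r subrr mulr0.
  rewrite -natr1 2!mulrDl mul1r.
  have h1 := IH (ltnW kn).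
  have h2 : m * prob [set w | crossing n w < N] <=
      2 * (\int[P]_w A (crossing k.+1 w) w - \int[P]_w A (crossing k w) w).
    apply: (@le_trans _ _ (m * prob [set w | crossing k.+1 w < N])).
      rewrite ler_pM2l// fine_le ?fin_num_measure//.
      apply: le_measure; rewrite ?inE// => w /= hw.
      by apply: le_lt_trans hw; exact: crossing_mono.
    exact: (prob_not_last hF K0 hX hA XK AK A_nd mean_X mean_Q (rS k) (rS k.+1)
      (r0 k) (@crossing_le k) (rleN k.+1) mu0 m0 mg mmu (@crossing_reached k)).
  lra.
apply: (le_trans (key n (leqnn n))).
rewrite ler_pM2l// lerBlDr.
have K' t w : `|A t w| <= K by have /andP[h1 h2] := AK t w; rewrite ger0_norm.
have iA := stopped_integrable P hF hA K' (rS n) (rN n).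
apply: (le_trans (@Rintegral_le_cst _ _ _ P _ setT K measurableT iA _)).
  by move=> w; case/andP: (AK (crossing n w) w).
rewrite probability_setT mulr1 lerDl; apply: Rintegral_ge0 => w _.
by case/andP: (AK 0 w).
Qed.

Section runs.
Variables (E : nat -> set Omega) (theta : R).
Hypothesis theta0 : 0 <= theta.
Hypothesis mE : forall i, past F (crossing i.+1) (E i).
Hypothesis prob_E : forall i B, past F (crossing i) B ->
  prob (B `&` E i) <= theta * prob B.

Definition run (i r : nat) : set Omega :=
  [set w | forall j, (j < r)%N -> E (i + j)%N w].

Lemma runS i r : run i r.+1 = run i r `&` E (i + r)%N.
Proof.
apply/seteqP; split => [w h|w [h1 h2] j].
  by split => [j jr|]; apply: h; rewrite // ltnS ltnW.
by rewrite ltnS leq_eqVlt => /predU1P[->|/h1].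
Qed.

Lemma run0 i : run i 0 = setT.
Proof. by apply/seteqP; split. Qed.

Lemma run_past i r : past F (crossing (i + r)) (run i r).
Proof.
elim: r => [|r IH]; first by rewrite run0; exact: real_stopping_past_setT.
rewrite runS addnS; apply: (sigma_setI (past_sigma hF (rS _))); last exact: mE.
by apply: (past_le hF _ (rS _)) IH => w; exact: crossing_le.
Qed.

Lemma run_measurable i r : measurable (run i r).
Proof. exact: (past_measurable hF (rleN (i + r)) (@run_past i r)). Qed.

Lemma prob_run i r : prob (run i r) <= theta ^+ r.
Proof.
elim: r => [|r IH]; first by rewrite run0 probability_setT.
rewrite runS; apply: (le_trans (prob_E (run_past i r))).
by rewrite exprS ler_wpM2l.
Qed.

Definition bad (n r : nat) : set Omega :=
  [set w | crossing n w < N] `|` \bigcup_(i < n) run i r.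

Lemma bad_measurable n r : measurable (bad n r).
Proof.
apply: measurableU; last by apply: bigcup_measurable => i _; exact: run_measurable.
by apply: (real_filtration_measurable hF (t := N)); exact: real_stopping_lt.
Qed.

Lemma prob_bad (m : R) (n r : nat) : 0 < m -> m <= g -> m <= mu ^+ 2 -> (0 < n)%N ->
  prob (bad n r) <= 2 * K / (n%:R * m) + n%:R * theta ^+ r.
Proof.
move=> m0 mg mmu n0.
have mcr : measurable [set w | crossing n w < N].
  by apply: (real_filtration_measurable hF (t := N)); exact: real_stopping_lt.
have mU : measurable (\bigcup_(i < n) run i r).
  by apply: bigcup_measurable => i _; exact: run_measurable.
have le1 : prob (bad n r) <=
    prob [set w | crossing n w < N] + prob (\bigcup_(i < n) run i r).
  rewrite -fineD ?fin_num_measure// fine_le ?fin_numD ?fin_num_measure//.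
  - exact: bad_measurable.
  - exact: measureU2.
apply: (le_trans le1); apply: lerD.
  rewrite ler_pdivlMr ?mulr_gt0 ?ltr0n// mulrC; exact: prob_crossing_lt.
elim: (n) => [|k IH].
  by rewrite bigcup_mkord big_ord0 measure0 mul0r.
have mUk : measurable (\bigcup_(i < k) run i r).
  by apply: bigcup_measurable => i _; exact: run_measurable.
have -> : \bigcup_(i < k.+1) run i r = (\bigcup_(i < k) run i r) `|` run k r.
  by rewrite !bigcup_mkord big_ord_recr.
have mrk := run_measurable k r.
apply: (@le_trans _ _ (prob (\bigcup_(i < k) run i r) + prob (run k r))).
  rewrite -fineD ?fin_num_measure// fine_le ?fin_numD ?fin_num_measure//.
  - exact: measurableU.
  - exact: measureU2.
by rewrite -natr1 mulrDl mul1r lerD// prob_run.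
Qed.

End runs.

Definition clock_step (i : nat) : set Omega :=
  [set w | g <= A (crossing i.+1 w) w - A (crossing i w) w].

Definition space_step (i : nat) : set Omega :=
  [set w | mu <= `|X (crossing i.+1 w) w - X (crossing i w) w|].

Lemma clock_step_past i : past F (crossing i.+1) (clock_step i).
Proof.
exact: (clock_step_measurable hF hA (rS i) (rS i.+1) (r0 i) (@crossing_le i)
  (rleN i.+1)).
Qed.

Lemma space_step_past i : past F (crossing i.+1) (space_step i).
Proof.
exact: (space_step_measurable hF hX (rS i) (rS i.+1) (r0 i) (@crossing_le i)
  (rleN i.+1)).
Qed.

Lemma prob_clock_step_crossing i B : past F (crossing i) B ->
  prob (B `&` clock_step i) <= mu ^+ 2 / g * prob B.
Proof.
apply: (prob_clock_step hF K0 hX hA XK AK A_nd mean_X mean_Q (rS i) (rS i.+1)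
  (r0 i) (@crossing_le i) (rleN i.+1) mu0 g0) => w.
by have [|] := @crossing_within i (crossing i.+1 w) w; rewrite ?crossing_le ?lexx.
Qed.

Lemma prob_space_step_crossing i B : past F (crossing i) B ->
  prob (B `&` space_step i) <= g / mu ^+ 2 * prob B.
Proof.
apply: (prob_space_step hF K0 hX hA XK AK mean_X mean_Q (rS i) (rS i.+1)
  (r0 i) (@crossing_le i) (rleN i.+1) mu0) => w.
by have [|] := @crossing_within i (crossing i.+1 w) w; rewrite ?crossing_le ?lexx.
Qed.

Lemma clock_modulus n r w (u v : R) : ~ bad clock_step n r w ->
  0 <= u -> u <= v -> v <= N ->
  (forall a b, u <= a <= v -> u <= b <= v -> `|X a w - X b w| < mu) ->
  A v w - A u w <= r.+1%:R * g.
Proof.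
move=> /not_orP[/negP hn hrun] u0 uv vN.
apply: (@clock_le_osc _ (X ^~ w) (A ^~ w) (crossing ^~ w) N mu g n r) => //.
- by move=> i; exact: crossing_le.
- by apply/eqP; rewrite eq_le rleN/= leNgt.
- by move=> s t _ st _; exact: A_nd.
- by move=> i s; exact: crossing_within.
- by move=> i; exact: crossing_reached.
- by move=> i ir h; apply: hrun; exists i.
Qed.

Lemma space_modulus n r w (u v : R) : ~ bad space_step n r w ->
  0 <= u -> u <= v -> v <= N ->
  A v w - A u w < g -> `|X v w - X u w| <= 2 * r.+1%:R * mu.
Proof.
move=> /not_orP[/negP hn hrun] u0 uv vN.
apply: (@osc_le_clock _ (X ^~ w) (A ^~ w) (crossing ^~ w) N mu g n r) => //.
- by move=> i; exact: crossing_le.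
- by apply/eqP; rewrite eq_le rleN/= leNgt.
- by move=> s t _ st _; exact: A_nd.
- by move=> i s; exact: crossing_within.
- by move=> i; exact: crossing_reached.
- by move=> i ir h; apply: hrun; exists i.
Qed.

End fixed_scale.

Lemma borel_cantelli_geometric (B : nat -> set Omega) (C : R) :
  (forall n, measurable (B n)) -> (forall n, prob (B n) <= C * 4^-1 ^+ n) ->
  {ae P, forall w, exists n0, forall n, (n0 <= n)%N -> ~ B n w}.
Proof.
move=> mB hB.
have C0 : 0 <= C.
  by have := hB 0%N; rewrite expr0 mulr1; apply: le_trans; exact: fine_ge0.
have S n : \sum_(0 <= i < n) prob (B i) <= 2 * C * (1 - 4^-1 ^+ n).
  elim: n => [|n IH]; first by rewrite big_nil expr0 subrr mulr0.
  rewrite big_nat_recr//= exprS; have := hB n; move: IH.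
  have : 0 <= C * 4^-1 ^+ n by rewrite mulr_ge0// exprn_ge0// invr_ge0.
  rewrite !mulrBr !mulr1; lra.
have lt_oo : (\sum_(n <oo) P (B n) < +oo)%E.
  apply: (@le_lt_trans _ _ (2 * C)%:E); last exact: ltry.
  apply: lime_le; first exact: is_cvg_nneseries.
  apply: nearW => n.
  rewrite (eq_bigr (fun i => (prob (B i))%:E)); last first.
    by move=> i _; rewrite fineK// fin_num_measure.
  rewrite sumEFin lee_fin; apply: (le_trans (S n)).
  by rewrite ler_piMr ?mulr_ge0// lerBlDr lerDl exprn_ge0// invr_ge0.
exists (lim_sup_set B); split.
- apply: bigcap_measurable => // k _; exact: bigcup_measurable.
- exact: lim_sup_set_cvg0.
- move=> w /= h k _; apply: contrapT => hk; apply: h; exists k => n kn Bn.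
  by apply: hk; exists n.
Qed.

Lemma two_sided_modulus : {ae P, forall w, exists n0 : nat,
  forall n, (n0 <= n)%N -> forall u v : R, 0 <= u -> u <= v -> v <= N ->
  ((forall a b, u <= a <= v -> u <= b <= v ->
      absdiff (X ^~ w) a b < 2^-1 ^+ n) ->
    sqrt_absdiff (A ^~ w) u v <= (8 * n%:R + 8) * 2^-1 ^+ n) /\
  (4 * sqrt_absdiff (A ^~ w) u v < 2^-1 ^+ n ->
    absdiff (X ^~ w) u v <= (8 * n%:R + 8) * 2^-1 ^+ n)}.
Proof.
(* When the clock threshold is 16 times [mu ^+ 2] a step is ended by the clock
   with conditional probability at most 1/16, and when it is a 16th of it a step
   is ended by the space threshold with that probability: among [16 ^ n] steps,
   runs of [2 * n] such steps are then summably unlikely. *)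
pose mu n : R := 2^-1 ^+ n.
have mu0 n : 0 < mu n by rewrite exprn_gt0// invr_gt0.
have mu2 n : mu n ^+ 2 = 4^-1 ^+ n.
  by rewrite /mu -exprM mulnC exprM; congr (_ ^+ n); field.
have mu20 n : 0 < mu n ^+ 2 by rewrite exprn_gt0.
pose g1 n := 16 * mu n ^+ 2; pose g2 n := mu n ^+ 2 / 16.
have g10 n : 0 < g1 n by rewrite mulr_gt0.
have g20 n : 0 < g2 n by rewrite divr_gt0.
pose B1 n := bad (mu n) (g1 n) (clock_step (mu n) (g1 n)) (16 ^ n) (2 * n).
pose B2 n := bad (mu n) (g2 n) (space_step (mu n) (g2 n)) (16 ^ n) (2 * n).
have bound n (c t : R) : c <= 2 * K / ((16 ^ n)%:R * (mu n ^+ 2 / 16)) +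
    (16 ^ n)%:R * t ^+ (2 * n) -> t = 16^-1 -> c <= (32 * K + 1) * 4^-1 ^+ n.
  move=> hc tE; apply: (le_trans hc); rewrite [leRHS]mulrDl [X in _ <= _ + X]mul1r.
  pose p : R := 4 ^+ n.
  have p0 : 0 < p by rewrite exprn_gt0.
  have p1 : 1 <= p by rewrite exprn_ege1// ler1n.
  have p16 : (16 ^ n)%:R = p ^+ 2 :> R.
    by rewrite natrX /p -exprM mulnC exprM; congr (_ ^+ n); ring.
  have p4 : 4^-1 ^+ n = p^-1 :> R by rewrite exprVn.
  rewrite mu2 p16 p4; apply: lerD.
    by rewrite le_eqVlt; apply/orP; left; apply/eqP; field; rewrite gt_eqF.
  have -> : t ^+ (2 * n) = (p ^+ 4)^-1.
    rewrite tE exprVn; congr (_^-1); rewrite -[16](_ : 4 ^+ 2 = _); last by ring.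
    by rewrite -exprM /p -exprM; congr (_ ^+ _); lia.
  have -> : p ^+ 2 * (p ^+ 4)^-1 = p^-1 * p^-1 by field; rewrite gt_eqF.
  by rewrite ler_piMr ?invr_ge0 ?(ltW p0)// invf_le1.
have aux (x : R) : 0 < x -> x / 16 <= 16 * x /\ x / 16 <= x.
  by move=> x0; split; lra.
have ae1 : {ae P, forall w, exists n0, forall n, (n0 <= n)%N -> ~ B1 n w}.
  apply: (@borel_cantelli_geometric _ (32 * K + 1)) => n.
    apply: bad_measurable => // i; exact: clock_step_past.
  apply: (bound n _ (mu n ^+ 2 / g1 n)); last first.
    by rewrite /g1 invfM mulrCA divff ?mulr1// gt_eqF.
  apply: prob_bad => //.
  - by rewrite divr_ge0// ltW.
  - by move=> i; exact: clock_step_past.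
  - by move=> i B; exact: prob_clock_step_crossing.
  - exact: g20.
  - exact: (aux _ (mu20 n)).1.
  - exact: (aux _ (mu20 n)).2.
  - by rewrite expn_gt0.
have ae2 : {ae P, forall w, exists n0, forall n, (n0 <= n)%N -> ~ B2 n w}.
  apply: (@borel_cantelli_geometric _ (32 * K + 1)) => n.
    apply: bad_measurable => // i; exact: space_step_past.
  apply: (bound n _ (g2 n / mu n ^+ 2)); last first.
    by rewrite /g2 mulrAC divff ?mul1r// gt_eqF.
  apply: prob_bad => //.
  - by rewrite divr_ge0// ltW.
  - by move=> i; exact: space_step_past.
  - by move=> i B; exact: prob_space_step_crossing.
  - exact: g20.
  - exact: (aux _ (mu20 n)).2.
  - by rewrite expn_gt0.
apply: filterS2 ae1 ae2 => w [n1 h1] [n2 h2].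
exists (maxn n1 n2) => n; rewrite geq_max => /andP[n1n n2n] u v u0 uv vN.
have Auv : 0 <= A v w - A u w by rewrite subr_ge0 A_nd.
have absA : `|A u w - A v w| = A v w - A u w by rewrite distrC ger0_norm.
have n0 : 0 <= n%:R :> R by [].
have r1 : (2 * n).+1%:R = 2 * n%:R + 1 :> R by rewrite -natr1 natrM.
rewrite /sqrt_absdiff absA -/(mu n); split => [osc|small].
  have := clock_modulus (mu0 n) (g10 n) (h1 n n1n) u0 uv vN osc.
  rewrite sqrt_le_sqr; last by rewrite mulr_ge0 ?(ltW (mu0 n))// addr_ge0// mulr_ge0.
  move=> h; apply: (le_trans h); rewrite r1 /g1 exprMn mulrA.
  apply: ler_wpM2r; first exact: ltW.
  have : 0 <= n%:R ^+ 2 :> R by rewrite exprn_ge0.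
  rewrite !expr2; lra.
have Ag : A v w - A u w < g2 n.
  have := sqr_sqrtr Auv; have := sqrtr_ge0 (A v w - A u w).
  move: (Num.sqrt _) small => s small s0 <-.
  have : 0 < (mu n - 4 * s) * (mu n + 4 * s).
    by rewrite mulr_gt0// ?subr_gt0// ltr_wpDr// mulr_ge0.
  rewrite /g2 !expr2; lra.
have := space_modulus (mu0 n) (g20 n) (h2 n n2n) u0 uv vN Ag.
rewrite /absdiff distrC => h; apply: (le_trans h); rewrite r1.
by rewrite ler_wpM2r ?(ltW (mu0 n))//; lra.
Qed.

End Crossings.

Lemma eq_sub_sub (R : realType) (x y a b c e : R) :
  y - x = b - a -> y - c - (x - e) = b - c - (a - e).
Proof. by move=> h; lra. Qed.

(** * Localization *)

(* The filtration is not complete and the paths are only almost surely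
   continuous, so hitting times need not be stopping times. All processes are set
   to 0 on a fixed null set [Z], the filtration is enlarged so as not to see [Z],
   and everything is extended to negative times. *)
Section Regularization.
Context {R : realType} {d : measure_display} {Omega : measurableType d}.
Variables (P : probability Omega R) (F : R -> set (set Omega)).
Hypothesis hF : filtration F.
Variable Z : set Omega.
Hypotheses (mZ : measurable Z) (PZ : P Z = 0%E).
Implicit Types (W : R -> Omega -> R) (T : Omega -> \bar R).

Definition reg_filtration (t : R) : set (set Omega) :=
  [set B | measurable B /\ exists2 B', F (Num.max t 0) B' & B `\` Z = B' `\` Z].

Definition reg_process W (t : R) (w : Omega) : R :=
  if w \in Z then 0 else W (Num.max t 0) w.

Let max0 (t : R) : 0 <= Num.max t 0. Proof. by rewrite le_max lexx orbT. Qed.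

Let sF t : sigma_algebra setT (F (Num.max t 0)).
Proof. by case: hF => h _ _; exact: h. Qed.

Lemma reg_filtrationP : real_filtration reg_filtration.
Proof.
have [_ Fm FS] := hF; split.
- move=> t; split.
  + by split => //; exists set0; rewrite ?set0D//; exact: sigma_set0.
  + move=> B [mB [B' FB' BB']]; split; first by rewrite setTD; exact: measurableC.
    exists (~` B'); first exact: sigma_setC.
    rewrite setTD; apply/seteqP; split => w [Bw nZ]; split => // B'w; apply: Bw.
      by have : (B' `\` Z) w by []; rewrite -BB' => -[].
    by have : (B `\` Z) w by []; rewrite BB' => -[].
  + move=> B hB; split; first by apply: bigcup_measurable => n _; exact: (hB n).1.
    have /choice[B' hB'] n : exists B', F (Num.max t 0) B' /\ B n `\` Z = B' `\` Z.
      by have [_ [B' ? ?]] := hB n; exists B'.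
    exists (\bigcup_n B' n); first by apply: sigma_bigcup => // n; exact: (hB' n).1.
    by rewrite !setD_bigcupl; apply: eq_bigcupr => n _; exact: (hB' n).2.
- by move=> t B [].
- move=> s t st B [mB [B' FB' BB']]; split => //; exists B' => //.
  apply: FS FB' => //; rewrite ge_max !le_max st !lexx !orbT//.
Qed.

Lemma reg_preimage W t (B : set R) : reg_process W t @^-1` B `\` Z =
  W (Num.max t 0) @^-1` B `\` Z.
Proof.
by apply/seteqP; split => w /= [h nZ]; split => //; move: h;
  rewrite /reg_process memNset.
Qed.

Lemma reg_process_wrt W t : adapted F W ->
  measurable_wrt (reg_filtration t) (reg_process W t).
Proof.
move=> aW B mB; have FB := aW _ (max0 t) _ mB.
split; last by exists (W (Num.max t 0) @^-1` B) => //; exact: reg_preimage.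
have [_ Fm _] := hF.
have mW : measurable (W (Num.max t 0) @^-1` B) by exact: (Fm _ (max0 t)).
rewrite (_ : _ @^-1` _ = (W (Num.max t 0) @^-1` B `\` Z) `|`
    (Z `&` [set w | B 0])).
  apply: measurableU; first exact: measurableD.
  apply: measurableI => //; have [h|h] := pselect (B 0).
    by rewrite (_ : [set _ | _] = setT)//; apply/seteqP; split.
  by rewrite (_ : [set _ | _] = set0)//; apply/seteqP; split.
apply/seteqP; split => w /=; rewrite /reg_process.
  by case: ifPn => [/set_mem Zw h|/negP nZ h]; [right|left; split => // Zw;
    apply: nZ; exact: mem_set].
by move=> [[h nZ]|[Zw h]]; [rewrite memNset|rewrite mem_set].
Qed.

Lemma reg_process_adapted W : adapted F W ->
  (forall w, ~ Z w -> continuous (fun t : R => W (Num.max t 0) w)) ->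
  continuous_adapted reg_filtration (reg_process W).
Proof.
move=> aW cW; split => [t|w]; first exact: reg_process_wrt.
have [Zw|nZ] := pselect (Z w).
  rewrite (_ : _ ^~ w = fun=> 0); first by move=> t; exact: cvg_cst.
  by apply/funext => t; rewrite /reg_process mem_set.
rewrite (_ : _ ^~ w = fun t => W (Num.max t 0) w).
  exact: cW.
by apply/funext => t; rewrite /reg_process memNset.
Qed.

Lemma reg_process_integral W t B B' : 0 <= t -> P.-integrable setT (EFin \o W t) ->
  measurable B -> measurable B' -> B `\` Z = B' `\` Z ->
  (\int[P]_(w in B) (reg_process W t w)%:E = \int[P]_(w in B') (W t w)%:E)%E.
Proof.
move=> t0 iW mB mB' BB'.
rewrite (negligible_integral mZ mB') ?PZ//; last exact: integrableS iW.
rewrite -BB' setDE integral_mkcondr; apply: eq_integral => w _.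
rewrite patchE /reg_process /= max_l//; case: ifPn => [/set_mem Zw|/negP nZ].
  by rewrite memNset//= => h; apply: h.
by rewrite mem_set// => Zw; apply: nZ; exact: mem_set.
Qed.

Lemma reg_martingale W : martingale P F W ->
  (forall w, ~ Z w -> continuous (fun t : R => W (Num.max t 0) w)) ->
  cont_martingale P reg_filtration (reg_process W).
Proof.
move=> [aW iW mW] cW; have hW := reg_process_adapted aW cW.
have [_ Fm FS] := hF.
have mreg t : measurable_fun setT (reg_process W t).
  by apply: measurable_wrt_sub (hW.1 t) => B [].
split => //.
- move=> t; apply: le_integrable (iW _ (max0 t)) => //; first exact/measurable_EFinP.
  by move=> w _; rewrite /= lee_fin /reg_process; case: ifP => //; rewrite normr0.
- move=> s t st B [mB [B' FB' BB']].
  have mB' : measurable B' by exact: (Fm _ (max0 s)).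
  have regmax r : reg_process W r = reg_process W (Num.max r 0).
    by apply/funext => w; rewrite /reg_process (max_l (max0 r)).
  rewrite (regmax s) (regmax t) /Rintegral.
  rewrite !(@reg_process_integral W _ B B')//; try exact: iW.
  have mst : Num.max s 0 <= Num.max t 0 by rewrite ge_max !le_max st lexx !orbT.
  by have [_ _ ->] := mW _ _ (max0 s) mst.
Qed.

Definition reg_time T (N : R) (w : Omega) : R :=
  if w \in Z then N else fine (mine N%:E (T w)).

Lemma fine_mine (N : R) (x : \bar R) : 0 <= N -> (0 <= x)%E ->
  0 <= fine (mine N%:E x) <= N /\ ((fine (mine N%:E x))%:E <= x)%E /\
  forall s, s < N -> (fine (mine N%:E x) <= s) = (x <= s%:E)%E.
Proof.
move=> N0; case: x => [r|_|]//; last first.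
  rewrite minEle leey/= lexx N0; split => //; split; first by rewrite leey.
  by move=> s sN; rewrite leye_eq/= leNgt sN.
rewrite lee_fin => r0; rewrite -EFin_min /= lee_fin.
rewrite le_min N0 r0 !ge_min !lexx orbT; split => //; split => // s sN.
by rewrite ge_min lee_fin (leNgt N) sN.
Qed.

Lemma reg_time_itv T N w : stopping_time F T -> 0 <= N -> 0 <= reg_time T N w <= N.
Proof.
move=> [T0 _] N0; rewrite /reg_time; case: ifP => _; first by rewrite N0 lexx.
exact: (fine_mine N0 (T0 w)).1.
Qed.

Lemma reg_time_le T N w : stopping_time F T -> 0 <= N -> ~ Z w ->
  ((reg_time T N w)%:E <= T w)%E.
Proof.
by move=> [T0 _] N0 nZ; rewrite /reg_time memNset//; exact: (fine_mine N0 (T0 w)).2.1.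
Qed.

Lemma reg_time_stopping T N : stopping_time F T -> 0 <= N ->
  real_stopping reg_filtration (reg_time T N).
Proof.
move=> hT N0 t; have [T0 FT] := hT.
have [Nt|tN] := leP N t.
  rewrite (_ : [set _ | _] = setT).
    exact: (sigma_setT (real_filtration_sigma reg_filtrationP t)).
  apply/seteqP; split => w //= _; apply: le_trans Nt.
  by case/andP: (reg_time_itv w hT N0).
have [t0|t0] := ltP t 0.
  rewrite (_ : [set _ | _] = set0).
    exact: (sigma_set0 (real_filtration_sigma reg_filtrationP t)).
  apply/seteqP; split => w //=; apply/negP; rewrite -ltNge (lt_le_trans t0)//.
  by case/andP: (reg_time_itv w hT N0).
have E : [set w | reg_time T N w <= t] = [set w | (T w <= t%:E)%E] `\` Z.
  apply/seteqP; split => w /=; rewrite /reg_time.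
    case: ifPn => [_|/negP nZ]; first by rewrite leNgt tN.
    rewrite (fine_mine N0 (T0 w)).2.2// => h; split => // Zw; apply: nZ.
    exact: mem_set.
  by move=> [h nZ]; rewrite memNset// (fine_mine N0 (T0 w)).2.2.
have [_ Fm _] := hF.
split; first by rewrite E; apply: measurableD => //; exact: (Fm _ t0 _ (FT t t0)).
exists [set w | (T w <= t%:E)%E]; first by rewrite max_l//; exact: FT.
by rewrite E; apply/seteqP; split => w [h nZ]; [case: h|split].
Qed.


Section Localization.
Variables (M QM : R -> Omega -> R) (T1 T2 : Omega -> \bar R).
Hypotheses (aM : adapted F M) (aQM : adapted F QM).
Hypothesis cM : forall w, ~ Z w -> continuous (fun t : R => M (Num.max t 0) w).
Hypothesis cQM : forall w, ~ Z w -> continuous (fun t : R => QM (Num.max t 0) w).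
Hypothesis QM0 : forall w, ~ Z w -> QM 0 w = 0.
Hypothesis QM_nd : forall w, ~ Z w ->
  forall s t, 0 <= s -> s <= t -> QM s w <= QM t w.
Let Q t w := M t w ^+ 2 - QM t w.
Hypotheses (hT1 : stopping_time F T1) (hT2 : stopping_time F T2).
Hypothesis mart1 : martingale P F (fun t w => stopped T1 M t w - M 0 w).
Hypothesis mart2 : martingale P F (fun t w => stopped T2 Q t w - Q 0 w).
Variable N : R.
Hypothesis N0 : 0 < N.

Let G := reg_filtration.
Let hG : real_filtration G := reg_filtrationP.
Let Mr := reg_process M.
Let Ar := reg_process QM.
Let hMr : continuous_adapted G Mr := reg_process_adapted aM cM.
Let hAr : continuous_adapted G Ar := reg_process_adapted aQM cQM.

Let Ar_nd w s t : s <= t -> Ar s w <= Ar t w.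
Proof.
move=> st; rewrite /Ar /reg_process; case: ifPn => // /negP nZ.
apply: QM_nd => //; first by move=> Zw; apply: nZ; exact: mem_set.
by rewrite ge_max !le_max st lexx !orbT.
Qed.

Let Ar0 w t : t <= 0 -> Ar t w = 0.
Proof.
move=> t0; rewrite /Ar /reg_process; case: ifPn => // /negP nZ.
by rewrite max_r// QM0// => Zw; apply: nZ; exact: mem_set.
Qed.

Definition size_process (t : R) (w : Omega) : R :=
  Num.max (`|reg_process M t w| / N) (reg_process QM t w / N).

Let hsize : continuous_adapted G size_process.
Proof.
have [aMr cMr] := hMr; have [aAr cAr] := hAr.
split => [t|w t].
  have sG := real_filtration_sigma hG t.
  apply/(measurable_wrtP _ sG); apply: measurable_maxr.
    by apply: measurable_funM => //; apply: measurableT_comp => //;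
      apply/(measurable_wrtP _ sG).
  by apply: measurable_funM => //; apply/(measurable_wrtP _ sG).
have c1 : {for t, continuous (fun t => `|Mr t w| / N)}.
  by apply: cvgM; [apply: cvg_norm; exact: cMr|exact: cvg_cst].
have c2 : {for t, continuous (fun t => Ar t w / N)}.
  by apply: cvgM; [exact: cAr|exact: cvg_cst].
exact: (continuous_max c1 c2).
Qed.

Definition loc_time (w : Omega) : R :=
  Num.min (Num.min (reg_time T1 N w) (reg_time T2 N w)) (hitting size_process N w).

(* The truncation only acts when [N <= `|M 0 w|], in which case [loc_time w = 0]
   and the stopped path is constant. *)
Definition loc_space (t : R) (w : Omega) : R :=
  Num.max (- N) (Num.min N (reg_process M (Num.min t (loc_time w)) w)).

Definition loc_clock (t : R) (w : Omega) : R :=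
  reg_process QM (Num.min t (loc_time w)) w.

Lemma loc_time_itv w : 0 <= loc_time w <= N.
Proof.
have /andP[h1 h1'] := reg_time_itv w hT1 (ltW N0).
have /andP[h2 h2'] := reg_time_itv w hT2 (ltW N0).
have /andP[h3 h3'] := hitting_itv size_process (ltW N0) w.
by rewrite /loc_time !le_min h1 h2 h3 !ge_min h1'.
Qed.

Lemma loc_time_stopping : real_stopping G loc_time.
Proof.
apply: min_stopping => //; last exact: hitting_stopping (ltW N0) hsize.
by apply: min_stopping => //; exact: reg_time_stopping (ltW N0).
Qed.

Lemma loc_size w s : 0 < loc_time w -> s <= loc_time w ->
  `|Mr s w| <= N /\ Ar s w <= N.
Proof.
move=> U0 sU.
have H0 : 0 < hitting size_process N w.
  by apply: lt_le_trans U0 _; rewrite /loc_time ge_min lexx orbT.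
have sz r : 0 <= r -> r <= loc_time w -> `|Mr r w| <= N /\ Ar r w <= N.
  move=> r0 rU.
  have : size_process r w <= 1.
    apply: (hitting_le (ltW N0) hsize).
      by apply: ltW; apply: hitting_lt H0; [exact: ltW|].
    by rewrite r0 (le_trans rU)// /loc_time ge_min lexx orbT.
  by rewrite /size_process ge_max !ler_pdivrMr// !mul1r => /andP[].
have [s0|/ltW s0] := leP 0 s; first exact: sz.
have e W : reg_process W s w = reg_process W 0 w.
  by rewrite /reg_process max_r// maxxx.
by rewrite /Mr /Ar !e; apply: sz => //; exact: ltW.
Qed.

Lemma loc_spaceE t w : 0 < loc_time w ->
  loc_space t w = Mr (Num.min t (loc_time w)) w.
Proof.
move=> U0; have [|h _] := @loc_size w (Num.min t (loc_time w)) U0.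
  by rewrite ge_min lexx orbT.
move: h; rewrite ler_norml /loc_space => /andP[h1 h2].
by rewrite (min_r h2) max_r.
Qed.

Lemma loc_space_increment s t w (h : R -> R) :
  h (loc_space t w) - h (loc_space s w) =
  h (Mr (Num.min t (loc_time w)) w) - h (Mr (Num.min s (loc_time w)) w).
Proof.
have [U0|U0] := ltP 0 (loc_time w); first by rewrite !loc_spaceE.
have UE : loc_time w = 0.
  by apply/eqP; rewrite eq_le U0; case/andP: (loc_time_itv w).
have e r : reg_process M (Num.min r (loc_time w)) w = reg_process M 0 w.
  by rewrite UE /reg_process max_r ?maxxx// ge_min lexx orbT.
by rewrite /loc_space /Mr !e !subrr.
Qed.

Lemma loc_space_le t w : `|loc_space t w| <= N.
Proof.
have NN : - N <= N by rewrite -subr_ge0 opprK addr_ge0 ?ltW.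
by rewrite ler_norml /loc_space le_max lexx ge_max NN ge_min lexx.
Qed.

Lemma loc_clock_itv t w : 0 <= loc_clock t w <= N.
Proof.
rewrite /loc_clock; apply/andP; split.
  have [h|h] := leP (Num.min t (loc_time w)) 0; first by rewrite -/(Ar _ _) Ar0.
  by rewrite -(@Ar0 w 0 (lexx 0)) Ar_nd// ltW.
have [U0|U0] := ltP 0 (loc_time w).
  have [|_ h] := @loc_size w (Num.min t (loc_time w)) U0; last exact: h.
  by rewrite ge_min lexx orbT.
by rewrite -/(Ar _ _) Ar0 ?(ltW N0)// ge_min U0 orbT.
Qed.

Lemma loc_clock_nd w s t : s <= t -> loc_clock s w <= loc_clock t w.
Proof.
move=> st; apply: Ar_nd; move: (loc_time w) => U.
by rewrite le_min !ge_min st lexx orbT.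
Qed.

Lemma loc_clock_adapted : continuous_adapted G loc_clock.
Proof.
apply: (stopped_adapted hG _ hAr loc_time_stopping) => w.
by case/andP: (loc_time_itv w).
Qed.

Lemma loc_space_adapted : continuous_adapted G loc_space.
Proof.
have U0 w : 0 <= loc_time w by case/andP: (loc_time_itv w).
have [a c] := stopped_adapted hG U0 hMr loc_time_stopping.
split => [t|w t].
  have sG := real_filtration_sigma hG t.
  apply/(measurable_wrtP _ sG); apply: measurable_maxr => //.
  by apply: measurable_minr => //; apply/(measurable_wrtP _ sG).
have c1 : {for t, continuous (fun t => Num.min N (Mr (Num.min t (loc_time w)) w))}.
  apply: (@continuous_min _ _ (cst N)); first exact: cvg_cst.
  exact: c.
apply: (@continuous_max _ _ (cst (- N)) _ t _ c1); exact: cvg_cst.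
Qed.

Lemma stopped_mean W T (K : R) S :
  stopping_time F T -> martingale P F (fun t w => stopped T W t w - W 0 w) ->
  (forall w, ~ Z w -> continuous (fun t : R => W (Num.max t 0) w)) ->
  (forall w, loc_time w <= reg_time T N w) ->
  (forall w s, s <= loc_time w ->
    `|reg_process W s w - reg_process W 0 w| <= K) ->
  real_stopping G S -> (forall w, 0 <= S w <= N) ->
  \int[P]_w (reg_process W (Num.min (S w) (loc_time w)) w - reg_process W 0 w) = 0.
Proof.
move=> hT mW cW UT WK hS SN; have [T0 _] := hT.
pose V t w := stopped T W t w - W 0 w.
have cV w : ~ Z w -> continuous (fun t : R => V (Num.max t 0) w).
  move=> nZ; have cw := cW w nZ.
  have cmax : continuous (fun t : R => Num.max t 0).
    move=> t; apply: (@continuous_max _ _ id (cst 0)); first exact: cvg_id.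
    exact: cvg_cst.
  pose x t : R := fine (mine (Num.max t 0)%:E (T w)).
  have cx : continuous x.
    have := T0 w; rewrite /x; case: (T w) => [r _|_ t|//].
      rewrite (_ : (fun t => _) = (fun t => Num.min (Num.max t 0) r)); last first.
        by apply/funext => t; rewrite -EFin_min.
      move=> t; have c2 : {for t, continuous (cst r : R -> R)} by exact: cvg_cst.
      exact: (continuous_min (cmax t) c2).
    rewrite (_ : (fun t => _) = (fun t => Num.max t 0)); first exact: cmax.
    by apply/funext => r; rewrite minEle leey.
  have x0 t : 0 <= x t by case/andP: (fine_mine (max0 t) (T0 w)).1.
  move=> t; apply: cvgB; last exact: cvg_cst.
  rewrite /stopped (_ : (fun t => _) = (fun t => W (Num.max (x t) 0) w)); last first.
    by apply/funext => r; rewrite (max_l (x0 r)).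
  rewrite -[X in W X w](max_l (x0 t)).
  exact: (cvg_comp _ _ (cx t) (cw (x t))).
have hV := reg_martingale mW cV.
pose S' w := Num.min (S w) (loc_time w).
have hS' : real_stopping G S' := min_stopping hG hS loc_time_stopping.
have S'N w : 0 <= S' w <= N.
  have /andP[h1 h2] := SN w; have /andP[h3 _] := loc_time_itv w.
  by rewrite le_min h1 h3 ge_min h2.
have VE w s : 0 <= s -> s <= loc_time w ->
    reg_process V s w = reg_process W s w - reg_process W 0 w.
  move=> s0 sU; rewrite /reg_process; case: ifPn => [_|/negP nZ].
    by rewrite subrr.
  have {}nZ : ~ Z w by move=> Zw; apply: nZ; exact: mem_set.
  rewrite /V /stopped maxxx max_l// minEle.
  have -> : (s%:E <= T w)%E.
    apply: le_trans (reg_time_le hT (ltW N0) nZ).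
    by rewrite lee_fin (le_trans sU).
  by [].
have S'U w : S' w <= loc_time w by rewrite ge_min lexx orbT.
have S'0 w : 0 <= S' w by case/andP: (S'N w).
transitivity (\int[P]_w reg_process V (S' w) w).
  by apply: eq_Rintegral => w _; rewrite VE.
rewrite (optional_stopping (K := K) hG hV hS' S'N); last first.
  by move=> w; rewrite VE//; exact: WK.
transitivity (\int[P]_w (0 : R)); last by rewrite Rintegral_cst// mul0r.
apply: eq_Rintegral => w _; rewrite VE ?subrr//.
by case/andP: (loc_time_itv w).
Qed.

Let reg_nonpos W w s : s <= 0 -> reg_process W s w = reg_process W 0 w.
Proof. by move=> s0; rewrite /reg_process max_r// maxxx. Qed.

Let QrE s w : reg_process Q s w = Mr s w ^+ 2 - Ar s w.
Proof.
by rewrite /Mr /Ar /reg_process; case: ifP => // _; rewrite expr0n/= subrr.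
Qed.

Let min0_loc w : Num.min 0 (loc_time w) = 0.
Proof. by rewrite min_l//; case/andP: (loc_time_itv w). Qed.

Lemma loc_mean_space S : real_stopping G S -> (forall w, 0 <= S w <= N) ->
  \int[P]_w loc_space (S w) w = \int[P]_w loc_space 0 w.
Proof.
move=> hS SN; apply/eqP; rewrite -subr_eq0; apply/eqP.
have h0 := cst_stopping hG 0.
have i1 := stopped_integrable P hG loc_space_adapted loc_space_le hS SN.
have i2 : P.-integrable setT (EFin \o (fun w => loc_space 0 w)).
  by apply: (stopped_integrable P hG loc_space_adapted loc_space_le h0) => w;
    rewrite lexx ltW.
rewrite -(RintegralB measurableT i1 i2).
rewrite -[RHS](@stopped_mean M T1 (2 * N) S) //.
- apply: eq_Rintegral => w _ /=.
  by have := loc_space_increment 0 (S w) w id; rewrite /= min0_loc.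
- by move=> w; rewrite /loc_time !ge_min lexx.
- move=> w s sU; have [U0|U0] := ltP 0 (loc_time w).
    have [h1 _] := loc_size U0 sU; have [h2 _] := loc_size U0 (ltW U0).
    by apply: (le_trans (ler_normB _ _)); rewrite mulr2n mulrDl mul1r lerD.
  by rewrite reg_nonpos ?(le_trans sU)// subrr normr0 mulr_ge0// ltW.
Qed.

Lemma loc_mean_clock S : real_stopping G S -> (forall w, 0 <= S w <= N) ->
  \int[P]_w (loc_space (S w) w ^+ 2 - loc_clock (S w) w) =
  \int[P]_w (loc_space 0 w ^+ 2 - loc_clock 0 w).
Proof.
move=> hS SN; apply/eqP; rewrite -subr_eq0; apply/eqP.
have N00 := ltW N0.
have clock_le t w : `|loc_clock t w| <= N.
  by have /andP[h1 h2] := loc_clock_itv t w; rewrite ger0_norm.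
have i S' : real_stopping G S' -> (forall w, 0 <= S' w <= N) ->
    P.-integrable setT (EFin \o (fun w => loc_space (S' w) w ^+ 2 - loc_clock (S' w) w)).
  move=> hS' S'N; apply: (@bounded_integrable _ _ _ P _ (N ^+ 2 + N)).
    apply: measurable_funB; last exact: (stopped_measurable hG S'N loc_clock_adapted).
    by apply: measurable_funX; exact: (stopped_measurable hG S'N loc_space_adapted).
  move=> w; apply: (le_trans (ler_normB _ _)); apply: lerD => //.
  by rewrite normrX lerXn2r ?nnegrE// loc_space_le.
have i2 := i _ (cst_stopping hG 0).
rewrite -(RintegralB measurableT (i _ hS SN) (i2 _)); last by move=> w; rewrite lexx.
have cQ w : ~ Z w -> continuous (fun t : R => Q (Num.max t 0) w).
  move=> nZ t; apply: cvgB; last exact: cQM.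
  by rewrite /=; under eq_fun do rewrite expr2; rewrite expr2; apply: cvgM; exact: cM.
rewrite -[RHS](@stopped_mean Q T2 (2 * (N ^+ 2 + N)) S) //.
- apply: eq_Rintegral => w _ /=.
  have := loc_space_increment 0 (S w) w (fun x => x ^+ 2).
  rewrite /= !QrE min0_loc /loc_clock min0_loc; exact: eq_sub_sub.
- by move=> w; rewrite /loc_time !ge_min lexx orbT.
- move=> w s sU; have [U0|U0] := ltP 0 (loc_time w); last first.
    rewrite reg_nonpos ?(le_trans sU)// subrr normr0 mulr_ge0// addr_ge0//.
    exact: exprn_ge0.
  have b r : r <= loc_time w -> `|reg_process Q r w| <= N ^+ 2 + N.
    move=> rU; have [h1 h2] := loc_size U0 rU; rewrite QrE.
    apply: (le_trans (ler_normB _ _)); apply: lerD.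
      by rewrite normrX lerXn2r ?nnegrE.
    have Ar_ge0 : 0 <= Ar r w.
      have [r0|r0] := leP r 0; first by rewrite Ar0.
      by rewrite -(Ar0 w (lexx 0)) Ar_nd// ltW.
    by rewrite ger0_norm.
  by apply: (le_trans (ler_normB _ _)); rewrite mulr2n mulrDl mul1r lerD// b// ltW.
Qed.

Definition loc_modulus := two_sided_modulus hG (ltW N0) (ltW N0) loc_space_adapted
  loc_clock_adapted loc_space_le loc_clock_itv loc_clock_nd loc_mean_space
  loc_mean_clock.

Lemma loc_eq w u : ~ Z w -> 0 < loc_time w -> 0 <= u <= loc_time w ->
  loc_space u w = M u w /\ loc_clock u w = QM u w.
Proof.
move=> nZ U0 /andP[u0 uU].
by rewrite loc_spaceE// /loc_clock /Mr min_l// /reg_process memNset// max_l.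
Qed.

Lemma loc_time_ge w t : ~ Z w -> 0 <= t -> t < N ->
  (t%:E <= T1 w)%E -> (t%:E <= T2 w)%E ->
  (forall s, 0 <= s <= t -> `|M s w| < N /\ QM s w < N) -> t <= loc_time w.
Proof.
move=> nZ t0 tN tT1 tT2 small.
have T_ge T : stopping_time F T -> (t%:E <= T w)%E -> t <= reg_time T N w.
  move=> [T0 _] tT; rewrite /reg_time memNset//.
  move: tT (T0 w); case: (T w) => [r|_|]//.
    by rewrite lee_fin => tr _; rewrite -EFin_min /= le_min tr ltW.
  by move=> _; rewrite minEle leey/= ltW.
rewrite /loc_time !le_min !T_ge//= leNgt; apply/negP => Ht.
have HN := lt_trans Ht tN.
have /andP[H0 _] := hitting_itv size_process (ltW N0) w.
have := hitting_ge (ltW N0) hsize HN.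
rewrite /size_process le_max !ler_pdivlMr// !mul1r /reg_process memNset// max_l//.
have [|h1 h2] := small (hitting size_process N w); first by rewrite H0 ltW.
by rewrite !leNgt h1 h2.
Qed.

End Localization.

End Regularization.

Section PathScales.
Context {R : realType}.
Implicit Types (f q : R -> R).

Lemma dominated_of_scales f q (t K : R) (n0 : nat) : 0 <= t -> 0 < K ->
  (forall u v, 0 <= u -> u <= v -> v <= t + 1 ->
    absdiff f u v <= K /\ sqrt_absdiff q u v <= K) ->
  (forall n, (n0 <= n)%N -> forall u v, 0 <= u -> u <= v -> v <= t + 1 ->
    ((forall a b, u <= a <= v -> u <= b <= v -> absdiff f a b < 2^-1 ^+ n) ->
      sqrt_absdiff q u v <= (8 * n%:R + 8) * 2^-1 ^+ n) /\
    (4 * sqrt_absdiff q u v < 2^-1 ^+ n ->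
      absdiff f u v <= (8 * n%:R + 8) * 2^-1 ^+ n)) ->
  increment_dominated (absdiff f) (sqrt_absdiff q) t /\
  increment_dominated (sqrt_absdiff q) (absdiff f) t.
Proof.
move=> t0 K0 bK h.
have ball_le v : ball t 1 v -> v <= t + 1.
  by rewrite /ball /= ltr_distlC => /andP[_ /ltW].
split => e e01; have [C C0 hC] := powR_of_scales n0 e01 K0.
  exists (C * 4 `^ (1 - e)), 1; split => //; first by rewrite mulr_gt0 ?powR_gt0.
  move=> u v m u0 v0 bu /ball_le vt uv m0 hm.
  rewrite -mulrA -powRM//; apply: hC; first by rewrite mulr_ge0.
    exact: (bK u v u0 uv vt).1.
  move=> n nn0 hmn; apply: (h n nn0 u v u0 uv vt).2.
  by apply: le_lt_trans hmn; rewrite ler_pM2l// hm// lexx uv.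
exists C, 1; split => // u v m u0 v0 bu /ball_le vt uv m0 hm.
apply: hC => //; first exact: (bK u v u0 uv vt).2.
move=> n nn0 hmn; apply: (h n nn0 u v u0 uv vt).1 => a b ha hb.
exact: le_lt_trans (hm a b ha hb) hmn.
Qed.

Lemma bounded_on_segment f (t : R) : continuous (fun u : R => f (Num.max u 0)) ->
  0 <= t -> exists K : R, forall s, 0 <= s <= t -> `|f s| <= K.
Proof.
move=> cf t0.
have cn : continuous (fun u : R => `|f (Num.max u 0)|).
  by move=> u; apply: cvg_norm; exact: cf.
have [c _ hc] := EVT_max t0 (continuous_subspaceT cn).
exists `|f (Num.max c 0)| => s s0t; have := hc s; rewrite in_itv/= => /(_ s0t).
by have /andP[s0 _] := s0t; rewrite (max_l s0).
Qed.

End PathScales.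

Theorem theorem4p1 (R : realType) (d : measure_display)
    (Omega : measurableType d) (P : probability Omega R)
    (F : R -> set (set Omega)) (M QM : R -> Omega -> R)
    (hF : filtration F)
    (hM : continuous_local_martingale P F M)
    (hQM : quadratic_variation P F M QM) :
  {ae P, forall w, forall t : R, 0 <= t ->
    [/\ forall s' : R,
          (- pseudo_pointwise_exponent half_line (M ^~ w) t <= s'%:E)%E ->
          (pseudo_frontier half_line (M ^~ w) t s' =
           (2^-1)%R%:E * pseudo_frontier half_line (QM ^~ w) t (2 * s')%R)%E,
        (pseudo_pointwise_exponent half_line (M ^~ w) t =
         (2^-1)%R%:E * pseudo_pointwise_exponent half_line (QM ^~ w) t)%E &
        (pseudo_local_exponent half_line (M ^~ w) t =
         (2^-1)%R%:E * pseudo_local_exponent half_line (QM ^~ w) t)%E]}.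
Proof.
move: hM hQM => [cM [aM [T [hT _ Too mT]]]].
move=> [aQM cQM ndQM [_ [_ [T' [hT' _ Too' mT']]]]].
have [Z [mZ PZ hZ]] : {ae P, forall w,
    ({within half_line, continuous (M ^~ w)} /\
     {within half_line, continuous (QM ^~ w)}) /\
    ((QM 0 w = 0 /\ forall s t, 0 <= s -> s <= t -> QM s w <= QM t w) /\
     ((T n w @[n --> \oo] --> +oo%E) /\ (T' n w @[n --> \oo] --> +oo%E)))}.
  by apply: filterI; [exact: filterI|apply: filterI; [|exact: filterI]].
have good w : ~ Z w ->
    [/\ continuous (fun t : R => M (Num.max t 0) w),
        continuous (fun t : R => QM (Num.max t 0) w), QM 0 w = 0,
        (forall s t, 0 <= s -> s <= t -> QM s w <= QM t w) &
        (T n w @[n --> \oo] --> +oo%E) /\ (T' n w @[n --> \oo] --> +oo%E)].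
  move=> nZ; have /contrapT/= [[h1 h2] [[h3 h4] h5]] := fun h => nZ (hZ w h).
  by split => //; [exact: (within_half_line_continuous h1)|
    exact: (within_half_line_continuous h2)].
have cM' w : ~ Z w -> continuous (fun t : R => M (Num.max t 0) w).
  by move=> /good[].
have cQM' w : ~ Z w -> continuous (fun t : R => QM (Num.max t 0) w).
  by move=> /good[].
have QM0 w : ~ Z w -> QM 0 w = 0 by move=> /good[].
have QMnd w : ~ Z w -> forall s t, 0 <= s -> s <= t -> QM s w <= QM t w.
  by move=> /good[].
have aeL := ae_foralln (fun L : nat => loc_modulus hF mZ PZ aM aQM cM' cQM' QM0 QMnd
  (hT L) (hT' L) (mT L) (mT' L) (ltr0Sn R L)).
have aeZ : {ae P, forall w, ~ Z w} by exists Z; split => // w /contrapT.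
apply: filterS2 aeL aeZ => w hL nZ t t0.
have [cMw cQw _ _ [Tw T'w]] := good w nZ.
have t10 : 0 <= t + 1 by rewrite addr_ge0.
have [K1 hK1] := @bounded_on_segment _ (M ^~ w) _ cMw t10.
have [K2 hK2] := @bounded_on_segment _ (QM ^~ w) _ cQw t10.
have [L [LT LT' Lt LK1 LK2]] : exists L : nat, [/\ ((t + 1)%:E <= T L w)%E,
    ((t + 1)%:E <= T' L w)%E, t + 1 < L.+1%:R, K1 < L.+1%:R & K2 < L.+1%:R].
  have : \forall L \near \oo, ((t + 1)%:E <= T L w)%E /\ ((t + 1)%:E <= T' L w)%E /\
      t + 1 < L.+1%:R /\ K1 < L.+1%:R /\ K2 < L.+1%:R.
    have natoo (x : R) : \forall L \near \oo, x < L.+1%:R.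
      exists (Num.truncn x) => // n /= xn; apply: (lt_le_trans (truncnS_gt x)).
      by rewrite ler_nat ltnS.
    apply: filterI; first by move/cvgeyPge : Tw; apply.
    apply: filterI; first by move/cvgeyPge : T'w; apply.
    by apply: filterI; [|apply: filterI]; exact: natoo.
  by move=> [n _ /(_ n (leqnn n))[? [? [? [? ?]]]]]; exists n.
set N : R := L.+1%:R in Lt LK1 LK2.
have N0 : 0 < N by rewrite ltr0n.
set U := loc_time Z M QM (T L) (T' L) N w.
have tU : t + 1 <= U.
  apply: (loc_time_ge hF mZ aM aQM cM' cQM' (hT L) (hT' L) N0) => // s st; split.
    by apply: le_lt_trans (hK1 s st) LK1.
  by apply: le_lt_trans (le_trans (ler_norm _) (hK2 s st)) LK2.
have U0 : 0 < U by apply: lt_le_trans tU; rewrite ltr_wpDl.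
have e u : 0 <= u <= t + 1 -> loc_space Z M QM (T L) (T' L) N u w = M u w /\
    loc_clock Z M QM (T L) (T' L) N u w = QM u w.
  move=> /andP[u0 ut]; apply: (loc_eq hF mZ aM aQM cM' cQM' N0) => //.
  by rewrite u0 (le_trans ut).
have [n0 hn0] := hL L.
have small u : 0 <= u <= t + 1 -> `|M u w| <= N /\ `|QM u w| <= N.
  by move=> hu; split; [apply: le_trans (hK1 u hu) (ltW LK1)|
    apply: le_trans (hK2 u hu) (ltW LK2)].
have K0 : 0 < 2 * N + 1 by rewrite addr_gt0 ?mulr_gt0.
have NU : t + 1 <= N.
  by apply: le_trans tU _; case/andP: (loc_time_itv Z M QM (hT L) (hT' L) N0 w).
have [||d1 d2] := @dominated_of_scales _ (M ^~ w) (QM ^~ w) t (2 * N + 1) n0 t0 K0.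
- move=> u v u0 uv vt.
  have [h1 h2] : `|M u w| <= N /\ `|QM u w| <= N.
    by apply: small; rewrite u0 (le_trans uv).
  have [h3 h4] : `|M v w| <= N /\ `|QM v w| <= N.
    by apply: small; rewrite vt (le_trans u0).
  split; first by apply: le_trans (ler_normB _ _) _; lra.
  rewrite /sqrt_absdiff sqrt_le_sqr ?(ltW K0)//.
  apply: (@le_trans _ _ (2 * N + 1)); first by apply: le_trans (ler_normB _ _) _; lra.
  by rewrite expr2 ler_peMr ?(ltW K0)//; lra.
- move=> n nn0 u v u0 uv vt.
  have eM r : 0 <= r <= t + 1 -> M r w = loc_space Z M QM (T L) (T' L) N r w.
    by move=> hr; have [-> _] := e r hr.
  have eQ r : 0 <= r <= t + 1 -> QM r w = loc_clock Z M QM (T L) (T' L) N r w.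
    by move=> hr; have [_ ->] := e r hr.
  have hu : 0 <= u <= t + 1 by rewrite u0 (le_trans uv).
  have hv : 0 <= v <= t + 1 by rewrite vt (le_trans u0).
  have [h1 h2] := hn0 n nn0 u v u0 uv (le_trans vt NU).
  rewrite /absdiff /sqrt_absdiff !eQ// !eM//; split => // osc; apply: h1 => a b ha hb.
  have /andP[ua av] := ha; have /andP[ub bv] := hb.
  rewrite /absdiff -!eM; first exact: osc.
    by rewrite (le_trans u0 ub) (le_trans bv).
  by rewrite (le_trans u0 ua) (le_trans av).
exact: exponents_half.
Qed.
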